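(* Let $\Sigma$ be a maximal strongly regular fan in a lattice $N$ whose rays span $N_{\mathbb{Q}}=N\otimes_{\mathbb{Z}}\mathbb{Q}$. Then there exist an abelian group $P$ and an admissible collection $\mathcal{A}=\{a_1,\ldots,a_r\}$ of elements in $P$ such that, up to an isomorphism of lattices, $\Sigma$ is equal to $$\Sigma(P,\mathcal{A}):=\{\sigma\in\Omega \ ;\ \Gamma(\sigma)=A\}.$$
   Context: Fans and strongly regular fans. Let $N$ be a lattice (a finitely generated free abelian group), $M=\mathrm{Hom}(N,\mathbb{Z})$, $N_{\mathbb{Q}}=N\otimes_{\mathbb{Z}}\mathbb{Q}$, with pairing $\langle\cdot,\cdot\rangle$. A fan $\Sigma$ in $N$ is a finite (nonempty) collection of strictly convex polyhedral cones in $N_{\mathbb{Q}}$ closed under taking faces and such that any two cones meet in a common face; $\Sigma(1)$ is its set of rays, and $n_\rho\in N$ is the primitive lattice vector on $\rho\in\Sigma(1)$. For $\rho\in\Sigma(1)$ let $\mathfrak{R}_\rho$ be the set of all $e\in M$ such that: (R1) $\langle n_\rho,e\rangle=-1$ and $\langle n_{\rho'},e\rangle\ge 0$ for all $\rho'\in\Sigma(1)$, $\rho'\ne\rho$; (R2) if $\sigma\in\Sigma$ and $\langle v,e\rangle=0$ for all $v\in\sigma$, then the cone generated by $\sigma$ and $\rho$ is in $\Sigma$. Elements of $\bigsqcup_{\rho}\mathfrak{R}_\rho$ are the roots of $\Sigma$. A cone $\sigma_2\in\Sigma$ is connected with its facet $\sigma_1$ by a root $e$ if $e|_{\sigma_2}\le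 0$ and $\sigma_1=\{v\in\sigma_2:\langle v,e\rangle=0\}$. A fan is strongly regular if every nonzero cone in it is connected with some of its facets by a root. A strongly regular fan $\Sigma$ is maximal if it is not a proper subfan of a strongly regular fan $\Sigma'$ with $\Sigma'(1)=\Sigma(1)$. Admissible collections. For a finite collection $\mathcal{A}=\{a_1,\ldots,a_r\}$ (possibly with repetitions) of elements of an abelian group $P$, the semigroup generated by a subcollection is the set of all its non-negative integer linear combinations (including $0$). $\mathcal{A}$ is admissible if it generates the group $P$ and each $a_i$ lies in the semigroup generated by $\mathcal{A}\setminus\{a_i\}$ (removing one occurrence). $A$ denotes the semigroup generated by $\mathcal{A}$. The fan $\Sigma(P,\mathcal{A})$. Given an admissible collection $\mathcal{A}$ in $P$, let $\beta\colon\mathbb{Z}^r\to P$ be the homomorphism sending the $i$-th standard basis vector to $a_i$, let $M$ be the kernel of $\beta$, $N=\mathrm{Hom}(M,\mathbb{Z})$, and let $n_i\in N$ be the restriction to $M\subseteq\mathbb{Z}^r$ of the $i$-th coordinate function. Let $\rho_i$ be the ray in $N_{\mathbb{Q}}$ spanned by $n_i$. $\Omega$ is the set of strictly convex polyhedral cones $\sigma$ in $N_{\mathbb{Q}}$ with all rays of $\sigma$ among $\rho_1,\ldots,\rho_r$. For $\sigma\in\Omega$ whose set of rays is $\{\rho_i, i\in I\}$, $\Gamma(\sigma)$ is the semigroup in $P$ generated by $a_j$, $j\notin I$. *)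

(* Defs.v *)
From HB Require Import structures.
From mathcomp Require Import all_boot all_order all_algebra generic_quotient.
From mathcomp Require Import mathcomp_extra boolp classical_sets functions.
From mathcomp Require Import cardinality ring.

Set Implicit Arguments.
Unset Strict Implicit.
Unset Printing Implicit Defensive.

Import Order.TTheory GRing.Theory Num.Theory.
Local Open Scope ring_scope.
Local Open Scope quotient_scope.
Local Open Scope classical_set_scope.

Definition is_lattice (N : zmodType) : Prop :=
  exists (n : nat) (f : {additive 'rV[int]_n -> N}), bijective f.

Definition dual (N : zmodType) : Type := {additive N -> int}.

HB.instance Definition _ (N : zmodType) := gen_eqMixin (dual N).
HB.instance Definition _ (N : zmodType) := gen_choiceMixin (dual N).

Section DualZmodule.
Variable N : zmodType.

Definition dual_zero : dual N := \0 : {additive N -> int}.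
Definition dual_add (e f : dual N) : dual N := (e \+ f : {additive N -> int}).
Definition dual_opp (e : dual N) : dual N := (\- e : {additive N -> int}).

Lemma dual_ext (e f : dual N) : (forall x, e x = f x) -> e = f.
Proof.
case: e f => [e [[He]]] [f [[Hf]]] /= /funext E; case: _ / E in Hf *.
by rewrite (Prop_irrelevance He Hf).
Qed.

Lemma dual_addA : associative dual_add.
Proof. by move=> e f g; apply: dual_ext => x; exact: addrA. Qed.
Lemma dual_addC : commutative dual_add.
Proof. by move=> e f; apply: dual_ext => x; exact: addrC. Qed.
Lemma dual_add0 : left_id dual_zero dual_add.
Proof. by move=> e; apply: dual_ext => x; exact: add0r. Qed.
Lemma dual_addN : left_inverse dual_zero dual_opp dual_add.
Proof. by move=> e; apply: dual_ext => x; exact: addNr. Qed.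

HB.instance Definition _ :=
  GRing.isZmodule.Build (dual N) dual_addA dual_addC dual_add0 dual_addN.

End DualZmodule.

Section Rationalization.
Variable N : zmodType.

(* The pair (x, d) stands for the fraction x / (d + 1).  The factor m makes
   the relation transitive when N has torsion, so that the quotient is the
   tensor product of N and the rationals for every abelian group N. *)
Definition NQ_rel (u v : N * nat) : bool :=
  `[< exists m : nat, u.1 *+ (v.2.+1 * m.+1)%N = v.1 *+ (u.2.+1 * m.+1)%N >].

Lemma NQ_rel_refl : reflexive NQ_rel.
Proof. by move=> u; apply/asboolP; exists 0%N. Qed.

Lemma NQ_rel_sym : symmetric NQ_rel.
Proof. by move=> u v; apply/asboolP/asboolP=> -[m e]; exists m. Qed.

Lemma NQ_rel_trans : transitive NQ_rel.
Proof.
move=> [y b] [x a] [z c] /asboolP[/= m Exy] /asboolP[/= n Eyz].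
have [k Ek] : exists k, k.+1 = (b.+1 * (m.+1 * n.+1))%N by eexists.
apply/asboolP; exists k; rewrite Ek /=.
transitivity (y *+ (a.+1 * m.+1 * (c.+1 * n.+1))%N).
  by rewrite [RHS]mulrnA -Exy -mulrnA; congr (_ *+ _); ring.
rewrite mulnC mulrnA Eyz -mulrnA; congr (_ *+ _); ring.
Qed.

Canonical NQ_equiv := EquivRel NQ_rel NQ_rel_refl NQ_rel_sym NQ_rel_trans.

Definition NQ : Type := {eq_quot NQ_rel}.
HB.instance Definition _ : EqQuotient _ NQ_rel NQ := EqQuotient.on NQ.
HB.instance Definition _ := Choice.on NQ.

(* The fraction x / d, for d > 0. *)
Definition fracN (x : N) (d : nat) : NQ := \pi_NQ (x, d.-1).

Lemma fracN_eqP (x y : N) (d e : nat) : (0 < d)%N -> (0 < e)%N ->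
  fracN x d = fracN y e <->
  exists2 m : nat, (0 < m)%N & x *+ (e * m)%N = y *+ (d * m)%N.
Proof.
case: d e => [//|d] [//|e] _ _; split.
  by move/eqmodP/asboolP => [m E]; exists m.+1.
by move=> [[//|m] _ E]; apply/eqmodP/asboolP; exists m.
Qed.

Definition NQ_num (v : NQ) : N := (repr v).1.
Definition NQ_den (v : NQ) : nat := (repr v).2.+1.

Lemma NQ_den_gt0 v : (0 < NQ_den v)%N. Proof. by []. Qed.

Lemma NQ_numden v : fracN (NQ_num v) (NQ_den v) = v.
Proof. by rewrite /fracN /NQ_num /NQ_den /= -surjective_pairing reprK. Qed.

Definition NQ_zero : NQ := fracN 0 1.
Definition NQ_opp (u : NQ) : NQ := fracN (- NQ_num u) (NQ_den u).
Definition NQ_add (u v : NQ) : NQ :=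
  fracN (NQ_num u *+ NQ_den v + NQ_num v *+ NQ_den u) (NQ_den u * NQ_den v).
Definition NQ_scale (q : rat) (u : NQ) : NQ :=
  fracN (NQ_num u *~ numq q) (NQ_den u * `|denq q|).

Lemma NQ_oppE x d : (0 < d)%N -> NQ_opp (fracN x d) = fracN (- x) d.
Proof.
move=> d0; have := NQ_numden (fracN x d).
rewrite /NQ_opp; move: (NQ_num _) (NQ_den _) (NQ_den_gt0 (fracN x d)).
move=> y e e0 /fracN_eqP[] // m m0 E.
by apply/fracN_eqP => //; exists m; rewrite // !mulNrn E.
Qed.

Lemma NQ_addE x d y e : (0 < d)%N -> (0 < e)%N ->
  NQ_add (fracN x d) (fracN y e) = fracN (x *+ e + y *+ d) (d * e).
Proof.
move=> d0 e0; have := NQ_numden (fracN x d); have := NQ_numden (fracN y e).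
rewrite /NQ_add.
move: (NQ_num (fracN x d)) (NQ_den (fracN x d)) (NQ_den_gt0 (fracN x d)).
move: (NQ_num (fracN y e)) (NQ_den (fracN y e)) (NQ_den_gt0 (fracN y e)).
move=> y' e' e'0 x' d' d'0 /fracN_eqP[] // m m0 Ey /fracN_eqP[] // n n0 Ex.
apply/fracN_eqP; rewrite ?muln_gt0 ?d0 ?e0 ?d'0 ?e'0 //.
exists (m * n)%N; rewrite ?muln_gt0 ?m0 //.
rewrite !mulrnDl -!mulrnA; congr (_ + _).
  transitivity (x' *+ (d * n * (e' * e * m))%N); first by congr (_ *+ _); ring.
  by rewrite [LHS]mulrnA Ex -mulrnA; congr (_ *+ _); ring.
transitivity (y' *+ (e * m * (d' * d * n))%N); first by congr (_ *+ _); ring.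
by rewrite [LHS]mulrnA Ey -mulrnA; congr (_ *+ _); ring.
Qed.

Lemma absz_denq_gt0 (q : rat) : (0 < `|denq q|)%N.
Proof. by rewrite absz_gt0 denq_eq0. Qed.

Lemma NQ_scaleE q x d : (0 < d)%N ->
  NQ_scale q (fracN x d) = fracN (x *~ numq q) (d * `|denq q|).
Proof.
move=> d0; have := NQ_numden (fracN x d).
rewrite /NQ_scale; move: (NQ_num _) (NQ_den _) (NQ_den_gt0 (fracN x d)).
move=> y e e0 /fracN_eqP[] // m m0 E.
apply/fracN_eqP; rewrite ?muln_gt0 ?absz_denq_gt0 ?d0 ?e0 //; exists m => //.
move: E; rewrite !pmulrn -!mulrzA !PoszM => E.
transitivity (y *~ (d%:Z * m%:Z) *~ (`|denq q|%:Z * numq q)).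
  by rewrite -mulrzA; congr (_ *~ _); ring.
by rewrite E -mulrzA; congr (_ *~ _); ring.
Qed.


Lemma NQ_ind (P : NQ -> Prop) :
  (forall x d, (0 < d)%N -> P (fracN x d)) -> forall v, P v.
Proof. by move=> H v; rewrite -(NQ_numden v); exact: H. Qed.

Lemma NQ_addA : associative NQ_add.
Proof.
elim/NQ_ind=> x a a0; elim/NQ_ind=> y b b0; elim/NQ_ind=> z c c0.
rewrite !NQ_addE ?muln_gt0 ?a0 ?b0 // !mulnA !mulrnDl -!mulrnA -!addrA.
by rewrite (mulnC c a) (mulnC b a).
Qed.

Lemma NQ_addC : commutative NQ_add.
Proof.
elim/NQ_ind=> x a a0; elim/NQ_ind=> y b b0.
by rewrite !NQ_addE // addrC mulnC.
Qed.

Lemma NQ_add0 : left_id NQ_zero NQ_add.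
Proof.
by elim/NQ_ind=> x a a0; rewrite NQ_addE // mul0rn add0r mul1n.
Qed.

Lemma fracN0 d : (0 < d)%N -> fracN 0 d = NQ_zero.
Proof. by move=> d0; apply/fracN_eqP => //; exists 1%N; rewrite ?mul0rn. Qed.

Lemma NQ_addN : left_inverse NQ_zero NQ_opp NQ_add.
Proof.
elim/NQ_ind=> x a a0; rewrite NQ_oppE // NQ_addE // mulNrn addNr.
by rewrite fracN0 // muln_gt0 a0.
Qed.

HB.instance Definition _ :=
  GRing.isZmodule.Build NQ NQ_addA NQ_addC NQ_add0 NQ_addN.

Lemma NQ_scaleA p q v : NQ_scale p (NQ_scale q v) = NQ_scale (p * q) v.
Proof.
elim/NQ_ind: v => x a a0; rewrite !NQ_scaleE ?muln_gt0 ?a0 ?absz_denq_gt0 //.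
apply/fracN_eqP; rewrite ?muln_gt0 ?a0 ?absz_denq_gt0 //; exists 1%N => //.
rewrite !muln1 !pmulrn -!mulrzA !PoszM !absz_denq; congr (_ *~ _).
have E : numq (p * q) * (denq p * denq q) = numq p * numq q * denq (p * q).
  apply: (@intr_inj rat); rewrite !rmorphM /= !numqE; ring.
transitivity (a%:Z * (numq p * numq q * denq (p * q))); first by ring.
by rewrite -E; ring.
Qed.

Lemma NQ_scale1 : left_id 1 NQ_scale.
Proof. by elim/NQ_ind => x a a0; rewrite NQ_scaleE //= muln1. Qed.

Lemma NQ_scaleDr : right_distributive NQ_scale +%R.
Proof.
move=> q; elim/NQ_ind=> x a a0; elim/NQ_ind=> y b b0.
rewrite /GRing.add /= !(NQ_addE, NQ_scaleE) ?muln_gt0 ?a0 ?b0 ?absz_denq_gt0 //.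
apply/fracN_eqP; rewrite ?muln_gt0 ?a0 ?b0 ?absz_denq_gt0 //.
exists 1%N => //; rewrite !muln1 !pmulrn !mulrzDl -!mulrzA !PoszM.
by congr (_ *~ _ + _ *~ _); ring.
Qed.

Lemma NQ_scaleDl v : {morph NQ_scale^~ v : p q / p + q}.
Proof.
elim/NQ_ind: v => x a a0 p q.
rewrite [RHS]/GRing.add /= !NQ_scaleE // NQ_addE ?muln_gt0 ?a0 ?absz_denq_gt0 //.
apply/fracN_eqP; rewrite ?muln_gt0 ?a0 ?absz_denq_gt0 //; exists 1%N => //.
rewrite !muln1 !pmulrn -!mulrzA -mulrzDr -mulrzA !PoszM !absz_denq.
congr (_ *~ _).
have E : numq (p + q) * (denq p * denq q)
    = (numq p * denq q + numq q * denq p) * denq (p + q).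
  by apply: (@intr_inj rat); rewrite !(rmorphM, rmorphD) /= !numqE; ring.
transitivity (a%:Z * a%:Z * (numq (p + q) * (denq p * denq q))); first by ring.
by rewrite E; ring.
Qed.

HB.instance Definition _ := GRing.Zmodule_isLmodule.Build rat NQ
  NQ_scaleA NQ_scale1 NQ_scaleDr NQ_scaleDl.

Definition toNQ (x : N) : NQ := fracN x 1.

Lemma toNQ_is_zmod_morphism : zmod_morphism toNQ.
Proof.
move=> x y; rewrite /GRing.opp /GRing.add /= /toNQ NQ_oppE // NQ_addE //.
Qed.

HB.instance Definition _ :=
  GRing.isZmodMorphism.Build N NQ toNQ toNQ_is_zmod_morphism.

Lemma fracN_scale x d : (0 < d)%N -> fracN x d = d%:R^-1 *: toNQ x.
Proof.
move=> d0; have dn0 : d%:R != 0 :> rat by rewrite pnatr_eq0 -lt0n.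
apply: (scalerI dn0); rewrite scalerA divff // scale1r /toNQ.
rewrite [LHS]NQ_scaleE // pmulrn numq_int denq_int.
by apply/fracN_eqP; rewrite ?muln_gt0 ?d0 //; exists 1%N; rewrite // !muln1.
Qed.

(* Meaningful for additive f: its unique Q-linear extension to N_Q. *)
Definition extQ (V : lmodType rat) (f : N -> V) (v : NQ) : V :=
  (NQ_den v)%:R^-1 *: f (NQ_num v).

Lemma extQE (V : lmodType rat) (f : {additive N -> V}) x d : (0 < d)%N ->
  extQ f (fracN x d) = d%:R^-1 *: f x.
Proof.
move=> d0; have := NQ_numden (fracN x d).
rewrite /extQ; move: (NQ_num _) (NQ_den _) (NQ_den_gt0 (fracN x d)).
move=> y e e0 /fracN_eqP[] // m m0 /(congr1 f).
rewrite !raddfMn -!scaler_nat !natrM => E.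
have nz k : (0 < k)%N -> k%:R != 0 :> rat by rewrite pnatr_eq0 -lt0n.
have dem0 : d%:R * e%:R * m%:R != 0 :> rat by rewrite !mulf_neq0 ?nz.
apply: (scalerI dem0); rewrite !scalerA.
rewrite [X in X *: f y](_ : _ = d%:R * m%:R) ?E; last by field; rewrite nz.
by congr (_ *: _); field; rewrite nz.
Qed.

End Rationalization.

Arguments toNQ {N} x.

Definition pairing (N : zmodType) (v : NQ N) (e : dual N) : rat :=
  extQ (fun x : N => (e x)%:~R : rat^o) v.

Definition mapQ (N N' : zmodType) (f : N -> N') : NQ N -> NQ N' :=
  extQ (toNQ \o f).

Section Cones.
Variable V : lmodType rat.
Implicit Types (X : set V) (sigma tau rho : set V).

Definition cone_hull X : set V :=
  [set v | exists (n : nat) (c : 'I_n -> rat) (x : 'I_n -> V),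
     [/\ forall i, 0 <= c i, forall i, X (x i) & v = \sum_(i < n) c i *: x i]].

Definition lin_span X : set V :=
  [set v | exists (n : nat) (c : 'I_n -> rat) (x : 'I_n -> V),
     (forall i, X (x i)) /\ v = \sum_(i < n) c i *: x i].

Definition lin_indep (d : nat) (x : 'I_d -> V) : Prop :=
  forall c : 'I_d -> rat, \sum_(i < d) c i *: x i = 0 -> forall i, c i = 0.

Definition polyhedral sigma : Prop :=
  exists X : set V, finite_set X /\ sigma = cone_hull X.

Definition strictly_convex sigma : Prop :=
  forall v, sigma v -> sigma (- v) -> v = 0.

Definition face tau sigma : Prop :=
  exists u : {scalar V},
    (forall v, sigma v -> 0 <= u v) /\ tau = [set v | sigma v /\ u v = 0].

(* The family x is a basis of the linear span of sigma. *)
Definition cone_dim sigma (d : nat) : Prop :=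
  exists x : 'I_d -> V,
    [/\ lin_indep x, forall i, sigma (x i) & sigma `<=` lin_span (range x)].

Definition facet tau sigma : Prop :=
  face tau sigma /\ exists d, cone_dim tau d /\ cone_dim sigma d.+1.

Definition cone_rays sigma : set (set V) :=
  [set rho | face rho sigma /\ cone_dim rho 1].

Definition is_fan (Sigma : set (set V)) : Prop :=
  [/\ finite_set Sigma /\ Sigma !=set0,
      forall sigma, Sigma sigma -> polyhedral sigma /\ strictly_convex sigma,
      forall sigma tau, Sigma sigma -> face tau sigma -> Sigma tau
    & forall sigma tau, Sigma sigma -> Sigma tau ->
        face (sigma `&` tau) sigma /\ face (sigma `&` tau) tau].

Definition fan_rays (Sigma : set (set V)) : set (set V) :=
  [set rho | Sigma rho /\ cone_dim rho 1].

End Cones.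

Section StronglyRegular.
Variable N : zmodType.
Implicit Types (Sigma : set (set (NQ N))) (sigma tau rho : set (NQ N)).

Definition ray_of (n : N) : set (NQ N) := cone_hull [set toNQ n].

(* In particular n is nonzero, because 0 = 0 *+ k for all k. *)
Definition primitive (n : N) : Prop :=
  forall (m : N) (k : nat), n = m *+ k -> k = 1%N.

(* The default value 0 is never used when rho is a ray of a fan in a lattice. *)
Definition prim_gen rho : N :=
  xget 0 [set n | primitive n /\ rho = ray_of n].

Definition roots_at Sigma rho : set (dual N) :=
  [set e : dual N |
    [/\ e (prim_gen rho) = -1,
        forall rho', fan_rays Sigma rho' -> rho' <> rho ->
          0 <= e (prim_gen rho')
      & forall sigma, Sigma sigma -> (forall v, sigma v -> pairing v e = 0) ->
          Sigma (cone_hull (sigma `|` rho))]].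

Definition root Sigma (e : dual N) : Prop :=
  exists rho, fan_rays Sigma rho /\ roots_at Sigma rho e.

Definition connected_by (e : dual N) sigma2 sigma1 : Prop :=
  (forall v, sigma2 v -> pairing v e <= 0) /\
  sigma1 = [set v | sigma2 v /\ pairing v e = 0].

Definition strongly_regular Sigma : Prop :=
  is_fan Sigma /\
  forall sigma2, Sigma sigma2 -> sigma2 <> [set 0] ->
    exists (sigma1 : set (NQ N)) (e : dual N),
      [/\ facet sigma1 sigma2, root Sigma e & connected_by e sigma2 sigma1].

Definition maximal_strongly_regular Sigma : Prop :=
  strongly_regular Sigma /\
  ~ exists Sigma', [/\ strongly_regular Sigma',
                       fan_rays Sigma' = fan_rays Sigma & Sigma `<` Sigma'].

Definition rays_span Sigma : Prop :=
  lin_span (\bigcup_(rho in fan_rays Sigma) rho) = setT.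

End StronglyRegular.

Section Admissible.
Variables (P : zmodType) (r : nat) (a : 'I_r -> P).

Definition semigroup_gen (J : {set 'I_r}) : set P :=
  [set p | exists c : 'I_r -> nat, p = \sum_(i in J) a i *+ c i].

Definition admissible : Prop :=
  (forall p : P, exists c : 'I_r -> int, p = \sum_(i < r) a i *~ c i) /\
  (forall i, semigroup_gen (~: [set i]) (a i)).

Definition beta (u : 'rV[int]_r) : P := \sum_(i < r) a i *~ u ord0 i.

Lemma beta_is_zmod_morphism : zmod_morphism beta.
Proof.
move=> u v; rewrite /beta -sumrB; apply: eq_bigr => i _.
by rewrite !mxE mulrzBr.
Qed.

HB.instance Definition _ :=
  GRing.isZmodMorphism.Build 'rV[int]_r P beta beta_is_zmod_morphism.

Definition ker_beta : {pred 'rV[int]_r} := fun u => beta u == 0.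

Lemma ker_beta_zmod_closed : zmod_closed ker_beta.
Proof.
split=> [|u v]; rewrite !unfold_in /ker_beta ?raddf0 // => /eqP Eu /eqP Ev.
by rewrite [beta _]raddfB /= Eu Ev subr0.
Qed.

HB.instance Definition _ :=
  GRing.isZmodClosed.Build 'rV[int]_r ker_beta ker_beta_zmod_closed.

Record relations : Type :=
  Relation { relation_val : 'rV[int]_r; _ : relation_val \in ker_beta }.

HB.instance Definition _ := [isSub for relation_val].
HB.instance Definition _ := [Choice of relations by <:].
HB.instance Definition _ := [SubChoice_isSubZmodule of relations by <:].

(* The i-th coordinate of Z^r restricted to the kernel of beta. *)
Definition coord_fun (i : 'I_r) (u : relations) : int := relation_val u ord0 i.

Lemma coord_fun_is_zmod_morphism i : zmod_morphism (coord_fun i).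
Proof. by move=> u v; rewrite /coord_fun [relation_val _](raddfB val) !mxE. Qed.

HB.instance Definition _ i := GRing.isZmodMorphism.Build relations int
  (coord_fun i) (coord_fun_is_zmod_morphism i).

Definition coord (i : 'I_r) : dual relations :=
  coord_fun i : {additive relations -> int}.

Definition Omega : set (set (NQ (dual relations))) :=
  [set sigma | [/\ polyhedral sigma, strictly_convex sigma &
     cone_rays sigma `<=` range (fun i => ray_of (coord i))]].

(* When a is admissible the rays spanned by the coordinate functions are
   pairwise distinct, so each ray of a cone in Omega has a unique index. *)
Definition ray_indices (sigma : set (NQ (dual relations))) : {set 'I_r} :=
  [set i | `[< cone_rays sigma (ray_of (coord i)) >]]%SET.

Definition Gamma (sigma : set (NQ (dual relations))) : set P :=
  semigroup_gen (~: ray_indices sigma).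

Definition SigmaPA : set (set (NQ (dual relations))) :=
  [set sigma | Omega sigma /\ Gamma sigma = semigroup_gen [set: 'I_r]%SET].

End Admissible.

Arguments relations {P r} a.
Arguments coord {P r} a i.
Arguments Omega {P r} a.
Arguments ray_indices {P r} a sigma.
Arguments Gamma {P r} a sigma.
Arguments SigmaPA {P r} a.

(* Main.v *)
(* Call a set S of rays rooted if every ray in S has a character that is -1 on
   it, 0 on the other rays of S and nonnegative on all remaining rays.  The
   primitive vectors of a rooted set admit a dual family, so they span a
   simplicial cone, and these cones form a strongly regular fan, in which a
   character witnessing rootedness of S at a ray is a root connecting the cone
   with the facet opposite to that ray.  Conversely, going up along the facets
   given by strong regularity shows that every cone of Sigma is spanned by a
   rooted set, so by maximality Sigma is the fan of all rooted sets.

   Let P be the cokernel of the map sending a character to its values on the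
   primitive vectors, and let a_i be the classes of the standard basis vectors.
   Since the rays span, the relations among the a_i are the characters, and
   S is rooted iff each a_i with i in S lies in the semigroup generated by the
   a_j with j not in S, that is, iff Gamma = A. *)
Require Import Defs.
From HB Require Import structures.
From mathcomp Require Import all_boot all_order all_algebra.
From mathcomp Require Import generic_quotient ring_quotient.
From mathcomp Require Import boolp classical_sets functions cardinality.
From mathcomp Require Import ring.

Set Implicit Arguments.
Unset Strict Implicit.
Unset Printing Implicit Defensive.

Import Order.TTheory GRing.Theory Num.Theory.
Local Open Scope ring_scope.
Local Open Scope quotient_scope.
Local Open Scope classical_set_scope.

(** * Polyhedral cones and their rays *)

Section ConvexCones.
Variable V : lmodType rat.
Implicit Types (X C sigma tau rho : set V) (u : {scalar V}).

Definition convex_cone C : Prop :=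
  [/\ C 0, forall x y, C x -> C y -> C (x + y)
    & forall t x, 0 <= t -> C x -> C (t *: x)].

Lemma convex_cone_hull X : convex_cone (cone_hull X).
Proof.
split.
- exists 0, (fun=> 0), (fun=> 0); split=> [[]//|[]//|].
  by rewrite big_ord0.
- move=> _ _ [n [c [x [c0 Xx ->]]]] [m [d [y [d0 Yy ->]]]].
  exists (n + m)%N,
    (fun i => match fintype.split i with inl j => c j | inr j => d j end),
    (fun i => match fintype.split i with inl j => x j | inr j => y j end).
  split; [by move=> i; case: fintype.split|by move=> i; case: fintype.split|].
  rewrite big_split_ord /=; congr (_ + _); apply: eq_bigr => i _.
    by rewrite (unsplitK (inl i)).
  by rewrite (unsplitK (inr i)).
- move=> t _ t0 [n [c [x [c0 Xx ->]]]].
  exists n, (fun i => t * c i), x; split=> // [i|]; first exact: mulr_ge0.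
  by rewrite scaler_sumr; apply: eq_bigr => i _; rewrite scalerA.
Qed.

Lemma convex_cone_sum C (I : Type) (s : seq I) (P : pred I) (x : I -> V) :
  convex_cone C -> (forall i, P i -> C (x i)) -> C (\sum_(i <- s | P i) x i).
Proof.
by move=> [C0 CD _] Cx; elim/big_rec: _ => // i v Pi Cv; apply: CD => //;
  exact: Cx.
Qed.

Lemma sub_cone_hull X : X `<=` cone_hull X.
Proof.
move=> x Xx; exists 1, (fun=> 1), (fun=> x); split=> //.
by rewrite big_ord1 scale1r.
Qed.

Lemma cone_hull_min X C : convex_cone C -> X `<=` C -> cone_hull X `<=` C.
Proof.
move=> cC XC _ [n [c [x [c0 Xx ->]]]]; apply: convex_cone_sum => // i _.
by have [_ _ CZ] := cC; apply: CZ => //; exact: XC.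
Qed.

Lemma cone_hull_sub X Y : X `<=` cone_hull Y -> cone_hull X `<=` cone_hull Y.
Proof. by apply: cone_hull_min; exact: convex_cone_hull. Qed.

Lemma cone_hullS X Y : X `<=` Y -> cone_hull X `<=` cone_hull Y.
Proof.
by move=> XY; apply: cone_hull_sub; apply: subset_trans XY (@sub_cone_hull _).
Qed.

Lemma cone_hull1 (x : V) :
  cone_hull [set x] = [set v | exists2 t : rat, 0 <= t & v = t *: x].
Proof.
apply/seteqP; split=> [|_ [t t0 ->]]; last first.
  by have [_ _] := convex_cone_hull [set x]; apply => //; exact: sub_cone_hull.
apply: cone_hull_min => [|_ ->]; last by exists 1; rewrite ?scale1r.
split=> [|_ _ [s s0 ->] [t t0 ->]|s _ s0 [t t0 ->]].
- by exists 0; rewrite ?scale0r.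
- by exists (s + t); rewrite ?addr_ge0 ?scalerDl.
- by exists (s * t); rewrite ?mulr_ge0 ?scalerA.
Qed.

Lemma convex_cone_halfspace u : convex_cone [set v | 0 <= u v].
Proof.
split=> [|x y /= ux uy|t x t0 /= ux]; first by rewrite /= linear0.
- by rewrite linearD addr_ge0.
- by rewrite linearZ mulr_ge0.
Qed.

Lemma scalar_of (f : V -> rat) :
  (forall t x y, f (t *: x + y) = t * f x + f y) -> exists u, u =1 f.
Proof.
move=> lf; pose L := GRing.isLinear.Build _ _ _ _ f lf.
pose g : {scalar V} := HB.pack f L.
by exists g.
Qed.

(** This takes the place of finite dimensionality; for [NQ N] it comes from integral characters, in
    [separated_NQ]. *)
Definition separated : Prop := forall v : V, v != 0 -> exists u, u v != 0.

(* If u separates v from all generators but x, then project everything along x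
   onto the kernel of u and use induction on the number of generators. *)
Lemma farkas (sepV : separated) (s : seq V) (v : V) : ~ cone_hull [set` s] v ->
  exists u, (forall x, x \in s -> 0 <= u x) /\ u v < 0.
Proof.
have [n] := ubnP (size s); elim: n s v => // n IHn [|x s] v.
  move=> _ vs; have /sepV[u uv] : v != 0.
    by apply: contra_notN vs => /eqP->; have [] := convex_cone_hull [set` [::]].
  have [uv0|uv0] := ltP (u v) 0; first by exists u.
  have [w ew] : exists w : {scalar V}, w =1 (fun z => - u z).
    by apply: scalar_of => t z z'; rewrite linearP opprD mulrN.
  by exists w; split => //; rewrite ew oppr_lt0 lt0r uv.
rewrite /= ltnS => sn vs.
have [|u [us uv]] := IHn s v sn.
  by apply: contra_not vs; apply: cone_hullS => y /=; rewrite inE orbC => ->.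
have [ux|ux] := leP 0 (u x).
  by exists u; split=> // y; rewrite inE => /orP[/eqP->|/us].
(* Projection along [x] onto the kernel of [u], scaled by [- u x], which is positive. As [u v] is
   negative too, [v] is a nonnegative combination of [p v] and [x], so [p v] stays outside the cone
   of the projected generators. *)
pose p (z : V) := - u x *: z + u z *: x.
have [||w [ws wv]] := IHn (map p s) (p v); first by rewrite size_map.
  apply: contra_not vs => pv.
  have [_ HD HZ] := convex_cone_hull [set` x :: s].
  have Hx : cone_hull [set` x :: s] x by apply: sub_cone_hull;
    rewrite /= mem_head.
  have {}pv : cone_hull [set` x :: s] (p v).
    apply: cone_hull_sub pv => _ /mapP[y ys ->]; apply: (HD); apply: (HZ) => //.
    - by rewrite oppr_ge0 ltW.
    - by apply: sub_cone_hull; rewrite /= inE ys orbT.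
    - exact: us.
  have ux0 : - u x != 0 by rewrite oppr_eq0 lt_eqF.
  rewrite -[v](scalerK ux0) -[_ *: v](addrK (u v *: x)) -scaleNr.
  apply: (HZ); first by rewrite invr_ge0 oppr_ge0 ltW.
  by apply: (HD) => //; apply: (HZ); rewrite // oppr_ge0 ltW.
have [w' ew] : exists w' : {scalar V}, w' =1 w \o p.
  apply: scalar_of => t y z; rewrite /p /= !linearD !linearZ /=; ring.
exists w'; split=> [y|]; last by rewrite ew.
rewrite ew inE => /orP[/eqP->|ys] /=; last by apply: ws; exact: map_f.
by rewrite /p -scalerDl addNr scale0r linear0.
Qed.

Lemma cone_dim0 : cone_dim [set (0 : V)] 0.
Proof.
exists (fun=> 0); split=> [c _ []//|[]//|_ ->].
by exists 0%N, (fun=> 0), (fun=> 0); split=> [[]//|]; rewrite big_ord0.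
Qed.

Lemma lin_span_range d (x : 'I_d -> V) v : lin_span (range x) v ->
  exists c : 'I_d -> rat, v = \sum_(i < d) c i *: x i.
Proof.
move=> [n [c [y [yx ->]]]].
have /choice[f fE] : forall i, exists j, x j = y i.
  by move=> i; have [j _ <-] := yx i; exists j.
exists (fun j => \sum_(i | f i == j) c i).
under [RHS]eq_bigr do rewrite scaler_suml.
rewrite (partition_big f xpredT) //=; apply: eq_bigr => j _.
by apply: eq_bigr => i /eqP <-; rewrite fE.
Qed.

(** If [e < d], the [d] by [e] matrix of coefficients has a nonzero left kernel vector, which is a
    linear relation among the [x i]. *)
Lemma lin_indep_leq d e (x : 'I_d -> V) (y : 'I_e -> V) :
  lin_indep x -> (forall i, lin_span (range y) (x i)) -> (d <= e)%N.
Proof.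
move=> ix xy; rewrite leqNgt; apply/negP => ed.
have /choice[A xE] : forall i, exists c : 'I_e -> rat, x i = \sum_j c j *: y j.
  by move=> i; exact: lin_span_range.
pose M := \matrix_(i, j) A i j.
have [v vM v0] : exists2 v : 'rV[rat]_d, v *m M = 0 & v != 0.
  have : kermx M != 0.
    rewrite -mxrank_eq0 mxrank_ker -lt0n subn_gt0.
    exact: leq_ltn_trans (rank_leq_col M) ed.
  by move=> /rowV0Pn[v /sub_kermxP vM v0]; exists v.
case/eqP: v0; apply/rowP => i; rewrite mxE.
apply: (ix (v ord0)) => {i}.
under eq_bigr do rewrite xE scaler_sumr.
rewrite exchange_big big1 // => j _ /=.
under eq_bigr do rewrite scalerA.
rewrite -scaler_suml; have /rowP/(_ j) := vM; rewrite !mxE => E.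
rewrite [X in X *: _](_ : _ = 0) ?scale0r // -[RHS]E.
by apply: eq_bigr => i _; rewrite mxE.
Qed.

Lemma cone_dimS sigma tau d e : sigma `<=` tau ->
  cone_dim sigma d -> cone_dim tau e -> (d <= e)%N.
Proof.
move=> st [x [ix sx _]] [y [_ _ ty]]; apply: lin_indep_leq ix _ => i.
exact/ty/st.
Qed.

Lemma cone_dim_unique sigma d e : cone_dim sigma d -> cone_dim sigma e -> d = e.
Proof.
by move=> sd se; apply/eqP; rewrite eqn_leq !(@cone_dimS sigma sigma).
Qed.

Lemma cone_dim_ray (x : V) : x != 0 -> cone_dim (cone_hull [set x]) 1.
Proof.
move=> x0; exists (fun=> x); split=> [c|_|_ [n [c [y [_ yx ->]]]]].
- rewrite big_ord1 => /eqP; rewrite scaler_eq0 (negPf x0) orbF => /eqP c0 i.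
  by rewrite ord1.
- exact: sub_cone_hull.
- by exists n, c, y; split=> // i; exists ord0; rewrite // (yx i).
Qed.

Lemma cone_dim1E sigma : convex_cone sigma -> strictly_convex sigma ->
  cone_dim sigma 1 -> exists2 x, x != 0 & sigma = cone_hull [set x].
Proof.
move=> cs scs [x [ix sx span]]; exists (x ord0).
  apply/eqP => x0; have := ix (fun=> 1); rewrite big_ord1 x0 scaler0.
  by move=> /(_ erefl ord0)/eqP; rewrite oner_eq0.
have [_ _ sZ] := cs; rewrite cone_hull1; apply/seteqP;
  split=> [v sv|_ [t t0 ->]]; last exact: sZ.
have [c] := lin_span_range (span _ sv); rewrite big_ord1 => vE.
have [c0|c0] := leP 0 (c ord0); first by exists (c ord0).
(* A negative multiple of the spanning vector lies in the cone together with its opposite. *)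
have v0 : v = 0; last by exists 0; rewrite // scale0r.
apply: scs => //; rewrite vE -scaleNr; apply: (sZ) => //.
by rewrite oppr_ge0 ltW.
Qed.

(* For an irredundant generator x and another one y, Farkas' lemma applied to
   the generators and - x, - y gives a functional vanishing at x and positive at
   y; the sum of these over y exposes the ray of x. *)
Lemma cone_rays_generate (sepV : separated) sigma :
  polyhedral sigma -> strictly_convex sigma ->
  exists s : seq V, sigma = cone_hull [set` s] /\
    forall x, x \in s -> cone_rays sigma (cone_hull [set x]).
Proof.
move=> [X [/finite_seqP[s0 ->] es0]] scs.
(* A generating list of minimal length is irredundant. *)
pose gen n := `[< exists s : seq V, size s = n /\ sigma = cone_hull [set` s] >].
have exg : exists n, gen n by exists (size s0); apply/asboolP; exists s0.
case: (ex_minnP exg) => n /asboolP[s [sn es]] minn; exists s; split=> //.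
have irr x : x \in s -> ~ cone_hull [set` filter (predC1 x) s] x.
  move=> xs H; have /minn : gen (size (filter (predC1 x) s)).
    apply/asboolP; eexists; split; [by []|rewrite es].
    apply/seteqP; split; last by apply: cone_hullS => y /=;
      rewrite mem_filter => /andP[].
    apply: cone_hull_sub => y /= ys; have [->//|yx] := eqVneq y x.
    by apply: sub_cone_hull; rewrite /= mem_filter /= yx.
  rewrite leqNgt => /negP; apply; rewrite -sn size_filter.
  rewrite -(count_predC (pred1 x)) -[ltnLHS]add0n ltn_add2r -has_count
    has_pred1.
  exact: xs.
have nz x : x \in s -> x != 0.
  by move=> /irr; apply: contra_notN => /eqP xE; rewrite {2}xE;
    have [] := convex_cone_hull [set` filter (predC1 x) s].
move=> x xs; have xs' := irr x xs; set s' := filter _ s in xs'.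
have [H0 HD HZ] := convex_cone_hull [set` s'].
have sx : sigma x by rewrite es; exact: sub_cone_hull.
have s's : cone_hull [set` s'] `<=` sigma.
  by rewrite es; apply: cone_hullS => z /=; rewrite mem_filter => /andP[].
have [_ sD sZ] : convex_cone sigma by rewrite es; exact: convex_cone_hull.
have /choice[U HU] : forall y, exists u : {scalar V}, y \in s' ->
    [/\ forall z, z \in s' -> 0 <= u z, u x = 0 & 0 < u y].
  move=> y; have [ys'|//] := boolP (y \in s'); last by exists \0.
  have [|u [us uy]] := farkas sepV (s := [:: x, - x & s']) (v := - y).
    have sub : cone_hull [set` [:: x, - x & s']] `<=`
        [set z | exists t, cone_hull [set` s'] (z + t *: x)].
      apply: cone_hull_min => [|z /=].
        split=> [|z z' [t tz] [t' tz']|t z t0 [t' tz]].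
        - by exists 0; rewrite scale0r addr0.
        - by exists (t + t'); rewrite scalerDl addrACA; exact: HD.
        - by exists (t * t'); rewrite -scalerA -scalerDr; exact: HZ.
      rewrite !inE => /or3P[/eqP->|/eqP->|zs].
      - by exists (-1); rewrite scaleN1r subrr.
      - by exists 1; rewrite scale1r addNr.
      - by exists 0; rewrite scale0r addr0; exact: sub_cone_hull.
    (* Now [- y + t *: x] lies in the cone of [s']. If [0 < t], adding [y] puts [x] into that cone,
       against [irr]; if [t <= 0], then [- y] lies in [sigma], against strict convexity. *)
    move=> /sub[t H].
    have Hy : cone_hull [set` s'] y by exact: sub_cone_hull.
    have [t0|t0] := leP t 0; last first.
      apply: xs'; rewrite -[x](scalerK (lt0r_neq0 t0)); apply: (HZ).
        by rewrite invr_ge0 ltW.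
      by rewrite -[_ *: x](addKr (- y)) opprK; apply: (HD).
    have sy : sigma y by exact: s's.
    have /eqP := nz y (mem_subseq (filter_subseq _ _) ys'); apply.
    apply: scs => //; rewrite -[- y](addrK (t *: x)) -scaleNr; apply: (sD).
      exact: s's.
    by apply: (sZ); rewrite // oppr_ge0.
  exists u; move: us; rewrite linearN oppr_lt0 in uy => us.
  split=> // [z zs|]; first by apply: us; rewrite !inE zs !orbT.
  apply/eqP; rewrite eq_le us ?mem_head // -oppr_ge0 -linearN us //.
  by rewrite !inE eqxx orbT.
have [u eu] : exists u : {scalar V}, u =1 fun z => \sum_(y <- s') U y z.
  apply: scalar_of => t z z'; rewrite mulr_sumr -big_split;
    apply: eq_bigr => y _.
  by rewrite /= linearP.
have ux : u x = 0.
  by rewrite eu big_seq big1 // => y /HU[].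
have us' z : z \in s' -> 0 < u z.
  move=> zs'; rewrite eu (big_rem z) //= ltr_pwDl //.
    by have [_ _] := HU z zs'.
  rewrite big_seq; apply: sumr_ge0 => y /mem_rem /HU[H _ _]; exact: H.
have us z : z \in s -> 0 <= u z.
  move=> zs; have [->|zx] := eqVneq z x; first by rewrite ux.
  by apply/ltW/us'; rewrite mem_filter /= zx.
split; last exact/cone_dim_ray/nz.
exists u; split=> [v|].
  by rewrite es; apply: (@cone_hull_min _ [set v | 0 <= u v]);
    [exact: convex_cone_halfspace|exact: us].
apply/seteqP; split=> [v|v [sv uv]].
  rewrite cone_hull1 => -[t t0 ->]; split; first exact: sZ.
  by rewrite linearZ /= ux mulr0.
move: sv; rewrite es => -[m [c [z [c0 zs vE]]]].
have {}uv : \sum_(i < m) c i * u (z i) = 0.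
  rewrite vE linear_sum in uv; rewrite -[RHS]uv.
  by apply: eq_bigr => i _; rewrite linearZ.
rewrite vE; apply: convex_cone_sum => [|i _]; first exact: convex_cone_hull.
have /eqP : c i * u (z i) = 0.
  by apply: (psumr_eq0P _ uv) => // j _; apply: mulr_ge0 => //; exact/us/zs.
rewrite mulf_eq0 => /orP[/eqP->|uz].
  by rewrite scale0r; have [] := convex_cone_hull [set x].
rewrite cone_hull1; exists (c i) => //; congr (_ *: _); apply/eqP.
apply: contraTT uz => zx; rewrite gt_eqF // us' // mem_filter /= zx.
exact: zs.
Qed.

End ConvexCones.

Lemma cone_hull_image (V W : lmodType rat) (f : {linear V -> W}) (X : set V) :
  f @` cone_hull X = cone_hull (f @` X).
Proof.
apply/seteqP; split.
  move=> _ [_ [n [c [x [c0 Xx ->]]]] <-]; exists n, c, (f \o x).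
  split=> [//|i|]; first by exists (x i).
  by rewrite linear_sum; apply: eq_bigr => i _; rewrite linearZ.
apply: cone_hull_min => [|_ [x Xx <-]]; last by exists x;
  first exact: sub_cone_hull.
have [H0 HD HZ] := convex_cone_hull X.
split=> [|_ _ [x Hx <-] [y Hy <-]|t _ t0 [x Hx <-]].
- by exists 0; rewrite ?linear0.
- by exists (x + y); rewrite ?linearD //; exact: HD.
- by exists (t *: x); rewrite ?linearZ //; exact: HZ.
Qed.

(** * Cones generated by subfamilies of a finite family of vectors *)

Section GeneratedCones.
Variables (V : lmodType rat) (r : nat) (g : 'I_r -> V).
Implicit Types (S T : {set 'I_r}) (u : {scalar V}) (sigma tau rho : set V).

Definition cone_of S : set V := cone_hull (g @` [set` S]).

Lemma convex_cone_of S : convex_cone (cone_of S).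
Proof. exact: convex_cone_hull. Qed.

Lemma mem_cone_of S i : i \in S -> cone_of S (g i).
Proof. by move=> iS; apply: sub_cone_hull; exists i. Qed.

Lemma cone_ofP S v : cone_of S v <->
  exists c : 'I_r -> rat, (forall i, 0 <= c i) /\ v = \sum_(i in S) c i *: g i.
Proof.
split=> [|[c [c0 ->]]]; last first.
  apply: (@convex_cone_sum _ (cone_of S)) => [|i iS];
    first exact: convex_cone_of.
  by have [_ _ cZ] := convex_cone_of S; apply: cZ => //; exact: mem_cone_of.
move: v; apply: cone_hull_min => [|_ [i iS <-]]; last first.
  exists (fun k => (k == i)%:R); split; first by move=> k; rewrite ler0n.
  rewrite (bigD1 i) //= eqxx scale1r big1 ?addr0 // => k /andP[_ /negPf->].
  by rewrite scale0r.
split=> [|_ _ [c [c0 ->]] [d [d0 ->]]|t _ t0 [c [c0 ->]]].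
- by exists (fun=> 0); split=> //; rewrite big1 // => i _; rewrite scale0r.
- exists (fun i => c i + d i); split; first by move=> i; exact: addr_ge0.
  by rewrite -big_split; apply: eq_bigr => i _; rewrite scalerDl.
- exists (fun i => t * c i); split; first by move=> i; exact: mulr_ge0.
  by rewrite scaler_sumr; apply: eq_bigr => i _; rewrite scalerA.
Qed.

Lemma cone_of1 i : cone_of [set i]%SET = cone_hull [set g i].
Proof.
congr cone_hull; apply/seteqP; split=> [_ [k /= /set1P-> <-]//|_ ->].
by exists i; rewrite //= inE.
Qed.

Lemma cone_of0 : cone_of finset.set0 = [set 0].
Proof.
apply/seteqP; split=> [v /cone_ofP[c [_ ->]]|_ ->]; first by rewrite big_set0.
by have [] := convex_cone_of finset.set0.
Qed.

Lemma cone_ofS S T : (S \subset T)%SET -> cone_of S `<=` cone_of T.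
Proof.
by move=> /fintype.subsetP ST; apply: cone_hullS => _ [i iS <-];
  exists i => //; exact: ST.
Qed.

Lemma cone_ofU1 i S :
  cone_hull (cone_of S `|` cone_hull [set g i]) = cone_of (i |: S)%SET.
Proof.
apply/seteqP; split.
  apply: cone_hull_min; first exact: convex_cone_of.
  move=> v [|]; first by apply: cone_ofS; exact: finset.subsetUr.
  by rewrite -cone_of1; apply: cone_ofS; exact: finset.subsetUl.
apply: cone_hull_sub => _ [k /= /setU1P[->|kS] <-]; apply: sub_cone_hull.
  by right; exact: sub_cone_hull.
by left; exact: mem_cone_of.
Qed.

Lemma polyhedral_cone_of S : polyhedral (cone_of S).
Proof. by exists (g @` [set` S]); split=> //; exact/finite_image. Qed.

(** A sum of nonnegative terms vanishes only if every term does, so in a combination killed by [u]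
    the generators with positive value have coefficient zero. *)
Lemma exposed_cone_of S u : (forall i, i \in S -> 0 <= u (g i)) ->
  [set v | cone_of S v /\ u v = 0] = cone_of [set i in S | u (g i) == 0]%SET.
Proof.
move=> u0; apply/seteqP; split=> [_ [/cone_ofP[c [c0 ->]] uv]|v].
  rewrite linear_sum in uv; apply/cone_ofP; exists c; split=> //.
  rewrite (bigID (fun i => u (g i) == 0)) /= [X in _ + X]big1 ?addr0.
    by apply: eq_bigl => i; rewrite inE.
  move=> i /andP[iS ui].
  have /eqP : u (c i *: g i) = 0.
    apply: (psumr_eq0P _ uv) => // k kS; rewrite linearZ; apply: mulr_ge0 => //.
    exact: u0.
  by rewrite linearZ mulf_eq0 (negPf ui) orbF => /eqP->; rewrite scale0r.
move=> vS; split.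
  by apply: (cone_ofS _ vS); apply/fintype.subsetP => i; rewrite inE => /andP[].
have /cone_ofP[c [_ ->]] := vS.
rewrite linear_sum big1 // => i; rewrite inE => /andP[_ /eqP ui].
by rewrite linearZ /= ui mulr0.
Qed.

Lemma face_cone_ofE S tau : face tau (cone_of S) ->
  exists2 T : {set 'I_r}, (T \subset S)%SET & tau = cone_of T.
Proof.
move=> [u [u0 ->]]; exists [set i in S | u (g i) == 0]%SET.
  by apply/fintype.subsetP => i; rewrite inE => /andP[].
by apply: exposed_cone_of => i iS; exact/u0/mem_cone_of.
Qed.

(** Linear independence of the family indexed by [S], given through coordinate functionals on all of
    [V], because rootedness supplies exactly these. *)
Definition dual_to S : Prop := forall i, i \in S ->
  exists2 u : {scalar V}, u (g i) = 1 &
    forall k, k \in S -> k != i -> u (g k) = 0.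

Section DualFamily.
Variable S : {set 'I_r}.
Hypothesis dualS : dual_to S.

Lemma dual_coordinates : exists U : 'I_r -> {scalar V}, forall c i, i \in S ->
  U i (\sum_(k in S) c k *: g k) = c i.
Proof.
have /choice[U HU] : forall i, exists u : {scalar V}, i \in S ->
    u (g i) = 1 /\ forall k, k \in S -> k != i -> u (g k) = 0.
  move=> i; have [/dualS[u u1 u0]|//] := boolP (i \in S); last by exists \0.
  by exists u.
exists U => c i iS; have [u1 u0] := HU i iS.
rewrite linear_sum (bigD1 i) //= linearZ /= u1 mulr1 big1 ?addr0 //.
by move=> k /andP[kS ki]; rewrite linearZ /= u0 // mulr0.
Qed.

Lemma strictly_convex_cone_of : strictly_convex (cone_of S).
Proof.
have [U HU] := dual_coordinates.
move=> v /cone_ofP[c [c0 vE]] /cone_ofP[d [d0 vE']].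
rewrite vE big1 // => i iS; suff -> : c i = 0 by rewrite scale0r.
apply/eqP; rewrite eq_le c0 -(HU c) // -vE -oppr_ge0 -linearN vE' HU // d0.
by [].
Qed.

(** The face is exposed by the sum of the coordinate functionals at the indices of [S] outside
    [T]. *)
Lemma face_cone_of T : (T \subset S)%SET -> face (cone_of T) (cone_of S).
Proof.
move=> /fintype.subsetP TS; have [U HU] := dual_coordinates.
have HU' i k : i \in S -> k \in S -> U i (g k) = (k == i)%:R.
  move=> iS kS; rewrite eq_sym -(HU (fun j => (j == k)%:R)) //; congr (U i _).
  rewrite (bigD1 k) //= eqxx scale1r big1 ?addr0 // => j /andP[_ /negPf->].
  by rewrite scale0r.
have [u eu] : exists u : {scalar V}, u =1 fun v => \sum_(i in S :\: T) U i v.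
  apply: scalar_of => t x y; rewrite mulr_sumr -big_split.
  by apply: eq_bigr => i _; rewrite /= linearP.
have ug k : k \in S -> u (g k) = (k \notin T)%:R.
  move=> kS; rewrite eu; have [kT|kT] := boolP (k \in T).
    rewrite big1 // => i; rewrite inE => /andP[iT iS]; rewrite HU' //.
    by case: eqP => // ki; rewrite -ki kT in iT.
  rewrite (bigD1 k) ?inE ?kT //= HU' // eqxx big1 ?addr0 // => i.
  by rewrite inE => /andP[/andP[_ iS] ik]; rewrite HU' // eq_sym (negPf ik).
have u0 i : i \in S -> 0 <= u (g i) by move=> iS; rewrite ug // ler0n.
exists u; split=> [v /cone_ofP[c [c0 ->]]|].
  rewrite linear_sum; apply: sumr_ge0 => i iS; rewrite linearZ mulr_ge0 //.
  exact: u0.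
rewrite exposed_cone_of //; congr cone_of; apply/setP => i; rewrite inE.
have [iS|iS] /= := boolP (i \in S); last exact/negbTE/(contra (TS i)).
by rewrite ug // pnatr_eq0 eqb0 negbK.
Qed.

Lemma cone_dim_cone_of : cone_dim (cone_of S) #|S|.
Proof.
have [U HU] := dual_coordinates.
exists (fun k => g (enum_val k)); split.
(* The coefficients [c], indexed by the enumeration of [S], are carried over to ['I_r], with value 0
   outside [S]. *)
- move=> c H k; pose d i := if [pick k | enum_val k == i :> 'I_r] is Some k
    then c k else 0.
  have dE k' : d (enum_val k') = c k'.
    rewrite /d; case: pickP => [j /eqP/enum_val_inj->//|/(_ k')].
    by rewrite eqxx.
  rewrite -dE -(HU d) ?enum_valP // (big_enum_val) /=.
  under eq_bigr do rewrite dE.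
  by rewrite H linear0.
- by move=> k; apply: mem_cone_of; exact: enum_valP.
- move=> v /cone_ofP[c [_ ->]].
  exists #|S|, (c \o enum_val), (fun k => g (enum_val k)); split.
    by move=> k; exists k.
  by rewrite big_enum_val.
Qed.

End DualFamily.

End GeneratedCones.

Section Rays.
Variables (V : lmodType rat) (r : nat) (g : 'I_r -> V).
Implicit Types (S T : {set 'I_r}) (sigma rho : set V).

Lemma dual_toS S T : (T \subset S)%SET -> dual_to g S -> dual_to g T.
Proof.
move=> /fintype.subsetP TS dS i /TS/dS[u u1 u0]; exists u => // k /TS;
  exact: u0.
Qed.

Lemma cone_dim_cone_of1 S : dual_to g S -> cone_dim (cone_of g S) 1 ->
  exists2 i, i \in S & cone_of g S = cone_hull [set g i].
Proof.
move=> dS S1;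
have /eqP/cards1P[i ->] := cone_dim_unique (cone_dim_cone_of dS) S1.
by exists i; rewrite ?cone_of1 // inE.
Qed.

Lemma cone_rays_cone_of S rho : dual_to g S ->
  cone_rays (cone_of g S) rho <->
  exists2 i, i \in S & rho = cone_hull [set g i].
Proof.
move=> dS; split=> [[/face_cone_ofE[T TS ->]]|[i iS ->]].
  move=> /(cone_dim_cone_of1 (dual_toS TS dS))[i iT ->].
  by exists i => //; exact: (fintype.subsetP TS).
have iS' : ([set i] \subset S)%SET by rewrite finset.sub1set.
rewrite -cone_of1; split; first exact: face_cone_of.
by rewrite -(cards1 i); apply: cone_dim_cone_of; exact: dual_toS dS.
Qed.

(** By [cone_rays_generate] such a cone is generated by its rays. This is what recovers a cone of
    [Omega] from its [ray_indices]. *)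
Lemma cone_ofE sigma : separated V -> polyhedral sigma ->
  strictly_convex sigma ->
  cone_rays sigma `<=` range (fun i => cone_hull [set g i]) ->
  sigma = cone_of g [set i | `[< cone_rays sigma (cone_hull [set g i]) >]]%SET.
Proof.
move=> sepV ps scs rs; have [s [es srays]] := cone_rays_generate sepV ps scs.
apply/seteqP; split; last first.
  have cs : convex_cone sigma by rewrite es; exact: convex_cone_hull.
  apply: cone_hull_min => // _ [i /= + <-]; rewrite inE =>
    /asboolP[[u [_ e]] _].
  have : cone_hull [set g i] (g i) by exact: sub_cone_hull.
  by rewrite e => -[].
rewrite {1}es; apply: cone_hull_sub => x /= xs.
have [i _ ei] := rs _ (srays x xs).
have : cone_hull [set g i] x by rewrite ei; exact: sub_cone_hull.
rewrite -cone_of1; apply: cone_ofS; rewrite finset.sub1set inE.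
by apply/asboolP; rewrite ei; exact: srays.
Qed.

End Rays.

(** * The fan of rooted sets of rays *)

Section Rooted.
Variables (r : nat).
Implicit Types (S T : {set 'I_r}).

(* Used both for the characters of N, evaluated on the primitive vectors, and for
   the relations among the a_i, evaluated by their coordinates. *)
Definition rooted (M : Type) (ev : M -> 'I_r -> int) S : Prop :=
  forall i, i \in S -> exists e : M,
    [/\ ev e i = -1, forall k, k \in S -> k != i -> ev e k = 0
      & forall k, k \notin S -> 0 <= ev e k].

(** The same witnesses serve: at indices that leave the set, the value 0 counts as nonnegative. *)
Lemma rootedS (M : Type) (ev : M -> 'I_r -> int) S T :
  (T \subset S)%SET -> rooted ev S -> rooted ev T.
Proof.
move=> /fintype.subsetP TS rS i iT; have [e [e1 e0 ep]] := rS i (TS i iT).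
exists e; split=> // [k /TS kS ki|k kT]; first exact: e0.
have [kS|/ep//] := boolP (k \in S); rewrite e0 //.
by apply: contraNneq kT => ->.
Qed.

Lemma rooted_map (M M' : Type) (f : M -> M') (ev : M -> 'I_r -> int)
    (ev' : M' -> 'I_r -> int) S :
  (forall e i, ev' (f e) i = ev e i) -> rooted ev S -> rooted ev' S.
Proof.
move=> fE rS i /rS[e [e1 e0 ep]]; exists (f e); split=> [|k kS ki|k kS];
  rewrite fE //.
  exact: e0.
exact: ep.
Qed.

(* The old roots are corrected by multiples of e so that they vanish at i. *)
Lemma rootedU1 (M : zmodType) (ev : M -> 'I_r -> int) S i e :
  (forall i, zmod_morphism (ev^~ i)) ->
  rooted ev S -> ev e i = -1 -> (forall k, k \in S -> ev e k = 0) ->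
  (forall k, k != i -> 0 <= ev e k) -> rooted ev (i |: S)%SET.
Proof.
move=> evB rS e1 e0 ep.
have evD k x y : ev (x + y) k = ev x k + ev y k.
  have ev0 : ev 0 k = 0 by rewrite -(subrr 0) evB subrr.
  by rewrite -[y in LHS]opprK evB -(sub0r y) evB ev0 sub0r opprK.
have evM k x n : ev (x *+ n) k = ev x k *+ n.
  elim: n => [|n IHn]; first by rewrite !mulr0n -(subrr 0) evB subrr.
  by rewrite !mulrS evD IHn.
have iS : i \notin S by apply/negP => /e0; rewrite e1.
move=> k /setU1P[->|kS].
  exists e; split=> // [j /setU1P[->|/e0//]|j]; first by rewrite eqxx.
  by rewrite !inE negb_or => /andP[/ep].
have [f [f1 f0 fp]] := rS k kS.
(* Since [i] is not in [S], [ev f i] is nonnegative and equals its absolute value, which is taken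
   only to get a natural multiple. *)
exists (f + e *+ `|ev f i|%N); split=> [|j|j].
- by rewrite evD evM e0 // mul0rn addr0.
- move=> /setU1P[-> _|jS jk]; rewrite evD evM; last by rewrite e0 // f0 //
    mul0rn.
  by rewrite e1 mulNrn -mulr_natr mul1r natz gez0_abs ?subrr // fp.
- rewrite !inE negb_or => /andP[ji jS]; rewrite evD evM addr_ge0 ?fp //.
  by rewrite mulrn_wge0 // ep.
Qed.

End Rooted.

(** * Rational extension of characters, and primitive vectors on rays *)

Section RationalExtension.
Variable N : zmodType.

Lemma extQ_linear (V : lmodType rat) (f : {additive N -> V}) : linear (extQ f).
Proof.
move=> t; elim/NQ_ind=> x d d0; elim/NQ_ind=> y e e0.
rewrite [_ *: _]NQ_scaleE // [_ + _]NQ_addE ?muln_gt0 ?d0 ?absz_denq_gt0 //.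
rewrite !extQE ?muln_gt0 ?d0 ?e0 ?absz_denq_gt0 //.
have nz k : (0 < k)%N -> k%:R != 0 :> rat by rewrite pnatr_eq0 -lt0n.
have denE : `|denq t|%N%:R = (denq t)%:~R :> rat by rewrite -[in RHS]absz_denq.
have den0 : (denq t)%:~R != 0 :> rat by rewrite intr_eq0 denq_eq0.
rewrite raddfD !raddfMn raddfMz scalerDr -!scaler_nat -scaler_int !scalerA.
rewrite !natrM denE; congr (_ *: _ + _ *: _).
  by rewrite -[X in _ = X * _]divq_num_den; field; rewrite den0 !nz.
by field; rewrite den0 !nz.
Qed.

Lemma extQ_toNQ (V : lmodType rat) (f : {additive N -> V}) x :
  extQ f (toNQ x) = f x.
Proof. by rewrite extQE // invr1 scale1r. Qed.

Lemma pairing_scalar (e : dual N) :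
  exists2 u : {scalar NQ N}, (u =1 fun v => pairing v e) &
    forall x, u (toNQ x) = (e x)%:~R.
Proof.
pose f (x : N) : rat^o := (e x)%:~R.
have fB : zmod_morphism f by move=> x y; rewrite /f raddfB rmorphB.
pose L := GRing.isZmodMorphism.Build _ _ f fB.
pose h : {additive N -> rat^o} := HB.pack f L.
have [u eu] : exists u : {scalar NQ N}, u =1 extQ h.
  by apply: scalar_of => t x y; exact: (extQ_linear h).
by exists u => [v|x]; rewrite eu ?extQ_toNQ.
Qed.

(** Equivalently, the canonical map from [N] to its bidual is injective. *)
Definition torsionless : Prop := forall x : N, x != 0 ->
  exists e : dual N, e x != 0.

Lemma separated_NQ : torsionless -> separated (NQ N).
Proof.
move=> tN; elim/NQ_ind => x d d0; rewrite fracN_scale // => v0.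
have /tN[e ex] : x != 0 by apply: contraNneq v0 => ->;
  rewrite [toNQ 0]raddf0 scaler0.
have [u _ eu] := pairing_scalar e; exists u.
by rewrite linearZ mulf_neq0 ?eu ?intr_eq0 // invr_eq0 pnatr_eq0 -lt0n.
Qed.

(** Fix a character [e] with [e x] nonzero. Writing [x = y *+ k] with [k] different from 1 makes the
    absolute value of [e y] strictly smaller, so repeated division stops. *)
Lemma primitive_divisor (x : N) : torsionless -> x != 0 ->
  exists2 y, primitive y & exists2 k, (0 < k)%N & x = y *+ k.
Proof.
move=> tN /tN[e ex]; have [n] := ubnP `|e x|%N; elim: n x ex => // n IHn x ex.
rewrite ltnS => exn; have [px|/existsNP[y /existsNP[k /not_implyP[xE k1]]]] :=
  pselect (primitive x).
  by exists x => //; exists 1%N.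
have exE : e x = e y *+ k by rewrite xE raddfMn.
have k0 : (0 < k)%N by rewrite lt0n; apply: contraNneq ex => k0; rewrite exE k0.
have ey : e y != 0 by apply: contraNneq ex => y0; rewrite exE y0 mul0rn.
have [|z pz [l l0 yE]] := IHn y ey; last first.
  by exists z => //; exists (l * k)%N; rewrite ?muln_gt0 ?l0 // mulrnA -yE.
apply: leq_trans exn; rewrite exE -mulr_natr abszM natz absz_nat.
by rewrite ltn_Pmulr ?absz_gt0 // ltn_neqAle k0 andbT eq_sym; exact/eqP.
Qed.

(** Ensures that [prim_gen] does not fall back on its default: the ray is spanned by some [x / d],
    and a primitive divisor of [x] spans it too. *)
Lemma prim_gen_ray (rho : set (NQ N)) : torsionless -> convex_cone rho ->
  strictly_convex rho -> cone_dim rho 1 -> rho = ray_of (prim_gen rho).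
Proof.
move=> tN crho scrho drho.
suff [] : [set n | primitive n /\ rho = ray_of n] (prim_gen rho) by [].
apply: xgetPex.
have [v + ->] := cone_dim1E crho scrho drho.
elim/NQ_ind: v => x d d0; rewrite fracN_scale // => v0.
have x0 : x != 0 by apply: contraNneq v0 => ->; rewrite [toNQ 0]raddf0 scaler0.
have [y py [k k0 ->]] := primitive_divisor tN x0.
have q0 : 0 < d%:R^-1 * k%:R :> rat by rewrite mulr_gt0 ?invr_gt0 ?ltr0n.
exists y; split=> //; rewrite raddfMn -scaler_nat scalerA.
apply/seteqP; split; apply: cone_hull_sub => _ ->; rewrite cone_hull1.
  by exists (d%:R^-1 * k%:R); first exact: ltW.
exists (d%:R^-1 * k%:R)^-1; first by rewrite invr_ge0 ltW.
by rewrite scalerK // gt_eqF.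
Qed.

End RationalExtension.

(** * The cones of rooted sets form a strongly regular fan *)

Section RootedFan.
Variables (N : zmodType) (r : nat) (n : 'I_r -> N).
Implicit Types (S T : {set 'I_r}) (sigma tau rho : set (NQ N)).

Definition dual_ev (e : dual N) (i : 'I_r) : int := e (n i).

Let g i : NQ N := toNQ (n i).

Definition rooted_fan : set (set (NQ N)) :=
  [set cone_of g S | S in [set S | rooted dual_ev S]].

(** The coordinate functionals are the negatives of the characters witnessing rootedness. *)
Lemma rooted_dual_to S : rooted dual_ev S -> dual_to g S.
Proof.
move=> rS i /rS[e [e1 e0 _]]; have [u _ uE] := pairing_scalar (- e).
exists u => [|k kS ki]; rewrite uE [(- e) _]/(- e (n _)).
  by rewrite [e _]e1.
by rewrite [e _]e0.
Qed.

Lemma pairing_cone_of S (e : dual N) :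
  (forall i, i \in S -> 0 <= e (n i)) ->
  forall v, cone_of g S v -> 0 <= pairing v e.
Proof.
have [u eu uE] := pairing_scalar e.
move=> e0 v /cone_ofP[c [c0 ->]]; rewrite -eu linear_sum.
apply: sumr_ge0 => i iS; rewrite linearZ mulr_ge0 // uE ler0z; exact: e0.
Qed.

(** The character at [i] is negative on [n i] and nonnegative on every other [n k]. *)
Lemma ray_of_inj i k : rooted dual_ev [set i]%SET ->
  ray_of (n i) = ray_of (n k) -> i = k.
Proof.
move=> /(_ i)[]; rewrite ?inE // => e [e1 _ ep] ik; apply/eqP.
rewrite eq_sym; apply: contraT => ki.
have : cone_of g [set k] (g i).
  by rewrite cone_of1 -[cone_hull _]ik; exact: sub_cone_hull.
move=> /(pairing_cone_of (e := e)); have [u eu uE] := pairing_scalar e.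
rewrite -eu uE [e _]e1 => /(_ _)/[!oppr_ge0]; rewrite ler10; apply.
by move=> j /set1P->; apply: ep; rewrite inE.
Qed.

(** For [i] in [S] outside [T], the character at [i] is nonnegative on the cone of [T], while its
    value at [v] is minus the coefficient of [v] at [i]; hence that coefficient is zero. *)
Lemma rooted_cone_of_cap S T : rooted dual_ev S ->
  cone_of g S `&` cone_of g T = cone_of g (S :&: T)%SET.
Proof.
move=> rS; apply/seteqP; split=> [v [/cone_ofP[c [c0 vE]] vT]|v vST];
  last first.
  by split; apply: cone_ofS vST; rewrite ?finset.subsetIl ?finset.subsetIr.
apply/cone_ofP; exists c; split=> //; rewrite vE (big_setID T) /=.
rewrite [X in _ + X]big1 ?addr0 // => i; rewrite inE => /andP[iT iS].
have [e [e1 e0 ep]] := rS i iS; have [u eu uE] := pairing_scalar e.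
have : 0 <= u v.
  rewrite eu; apply: pairing_cone_of vT => k kT.
  have [kS|/ep//] := boolP (k \in S); rewrite [e _]e0 //.
  by apply: contraNneq iT => <-.
rewrite vE linear_sum (bigD1 i) //= big1 ?addr0 => [|k /andP[kS ki]];
  last first.
  by rewrite linearZ /= uE [e _]e0 // mulr0.
rewrite linearZ /= uE [e _]e1 mulrN1 oppr_ge0 => ci.
by rewrite (@le_anti _ _ (c i) 0) ?scale0r // ci c0.
Qed.

Lemma is_fan_rooted_fan : is_fan rooted_fan.
Proof.
split.
- split; first exact: finite_image.
  by exists (cone_of g finset.set0), finset.set0 => // i; rewrite inE.
- move=> _ [S rS <-]; split; first exact: polyhedral_cone_of.
  by apply: strictly_convex_cone_of; exact: rooted_dual_to.
- move=> _ tau [S rS <-] /face_cone_ofE[T TS ->]; exists T => //.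
  exact: rootedS rS.
- move=> _ _ [S rS <-] [T rT <-]; split.
    rewrite rooted_cone_of_cap //; apply: face_cone_of;
      first exact: rooted_dual_to.
    exact: finset.subsetIl.
  rewrite rooted_cone_of_cap //; apply: face_cone_of;
    first exact: rooted_dual_to.
  exact: finset.subsetIr.
Qed.

Hypothesis rooted1 : forall i, rooted dual_ev [set i]%SET.
Hypothesis prim_n : forall i, prim_gen (ray_of (n i)) = n i.

Lemma fan_rays_rooted_fan : fan_rays rooted_fan = range (fun i => ray_of (n i)).
Proof.
apply/seteqP; split=> [_ [[S rS <-]]|_ [i _ <-]].
  by move=> /(cone_dim_cone_of1 (rooted_dual_to rS))[i iS ->]; exists i.
rewrite /ray_of -(cone_of1 g i); split; first by exists [set i]%SET => //;
  exact: rooted1.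
rewrite -(cards1 i); apply: cone_dim_cone_of; exact: rooted_dual_to.
Qed.

(** Condition (R2) is [rootedU1]: if [e] vanishes on the cone of a rooted [S], adding [i] to [S]
    keeps it rooted. *)
Lemma roots_at_rooted_fan i (e : dual N) : e (n i) = -1 ->
  (forall k, k != i -> 0 <= e (n k)) -> roots_at rooted_fan (ray_of (n i)) e.
Proof.
move=> e1 ep; split=> [|rho|_ [S rS <-] e0]; first by rewrite prim_n.
  rewrite fan_rays_rooted_fan => -[k _ <-] ki; rewrite prim_n; apply: ep.
  by apply: contra_notN ki => /eqP->.
exists (i |: S)%SET; last by rewrite -cone_ofU1.
apply: rootedU1 e1 _ ep => // k kS; have := e0 _ (mem_cone_of g kS).
have [u eu uE] := pairing_scalar e.
by rewrite -eu uE => /eqP; rewrite intr_eq0 => /eqP.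
Qed.

Lemma facet_cone_ofD1 S i : dual_to g S -> i \in S ->
  facet (cone_of g (S :\ i)%SET) (cone_of g S).
Proof.
move=> dS iS; have sub : (S :\ i \subset S)%SET by exact: subD1set.
split; first exact: face_cone_of.
exists #|(S :\ i)%SET|; split; first by apply: cone_dim_cone_of;
  exact: dual_toS dS.
have -> : #|(S :\ i)%SET|.+1 = #|S| by rewrite (cardsD1 i S) iS.
exact: cone_dim_cone_of.
Qed.

Lemma strongly_regular_rooted_fan : strongly_regular rooted_fan.
Proof.
split; first exact: is_fan_rooted_fan.
move=> _ [S rS <-] nz; have [S0|[i iS]] := set_0Vmem S.
  by case: nz; rewrite S0 cone_of0.
have [e [e1 e0 ep]] := rS i iS.
exists (cone_of g (S :\ i)%SET), e; split.
- by apply: facet_cone_ofD1 => //; exact: rooted_dual_to.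
- exists (ray_of (n i)); split; first by rewrite fan_rays_rooted_fan; exists i.
  apply: roots_at_rooted_fan => // k ki.
  by have [kS|/ep//] := boolP (k \in S); rewrite [e _]e0.
(* On the cone [e] is nonpositive, whereas [exposed_cone_of] asks for a nonnegative functional,
   hence the passage to [- e]. *)
- have [u eu uE] := pairing_scalar (- e); have [w ew wE] := pairing_scalar e.
  have uw v : u v = - w v.
    elim/NQ_ind: v => x d d0; rewrite fracN_scale // !linearZ /= uE wE -mulrN.
    by rewrite -rmorphN.
  have u0 k : k \in S -> 0 <= u (g k).
    move=> kS; rewrite uw wE oppr_ge0; have [->|ki] := eqVneq k i.
      by rewrite [e _]e1.
    by rewrite [e _]e0.
  split=> [v vS|].
    rewrite -ew -oppr_ge0 -uw eu; apply: pairing_cone_of vS => k /u0.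
    by rewrite uE ler0z.
  have -> : [set v | cone_of g S v /\ pairing v e = 0] =
      [set v | cone_of g S v /\ u v = 0].
    apply/seteqP; split=> v [vS E]; split=> //; move: E; rewrite uw -ew => /eqP.
      by move=> /eqP ->; rewrite oppr0.
    by rewrite oppr_eq0 => /eqP.
  rewrite exposed_cone_of //; congr cone_of; apply/setP => k; rewrite !inE.
  have [kS|] := boolP (k \in S); last by rewrite andbF.
  rewrite andbT /= uw wE oppr_eq0 intr_eq0; have [->|ki] := eqVneq k i.
    by rewrite [e _]e1.
  by rewrite [e _]e0 ?eqxx.
Qed.

End RootedFan.

(** * Gale duality *)

Section Gamma.
Variables (P : zmodType) (r : nat) (a : 'I_r -> P).
Implicit Types (S : {set 'I_r}).

Definition coord_ev (u : relations a) (i : 'I_r) : int := coord_fun i u.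

Lemma semigroup_gen0 S : semigroup_gen a S 0.
Proof. by exists (fun=> 0%N); rewrite big1. Qed.

Lemma semigroup_genD S p q : semigroup_gen a S p -> semigroup_gen a S q ->
  semigroup_gen a S (p + q).
Proof.
move=> [c ->] [d ->]; exists (fun i => (c i + d i)%N); rewrite -big_split.
by apply: eq_bigr => i _; rewrite mulrnDr.
Qed.

Lemma mem_semigroup_gen S i : i \in S -> semigroup_gen a S (a i).
Proof.
move=> iS; exists (fun k => k == i : nat); rewrite (bigD1 i) //= eqxx big1
  ?addr0 //.
by move=> k /andP[_ /negPf->].
Qed.

Lemma semigroup_gen_sub S T : (forall i, i \in S -> semigroup_gen a T (a i)) ->
  semigroup_gen a S `<=` semigroup_gen a T.
Proof.
move=> ST _ [c ->]; elim/big_rec: _ => [|i p iS Tp];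
  first exact: semigroup_gen0.
apply: semigroup_genD Tp; elim: (c i) => [|m IHm]; first exact: semigroup_gen0.
by rewrite mulrS; apply: semigroup_genD IHm; exact: ST.
Qed.

(** A relation with coefficient -1 at [i], 0 on the rest of [S] and nonnegative coefficients outside
    [S] is an expression of [a i] in the semigroup of the complement. *)
Lemma rooted_semigroup_gen S : rooted coord_ev S <->
  forall i, i \in S -> semigroup_gen a (~: S) (a i).
Proof.
split=> [rS i iS|gS i iS].
  have [[u ku] [u1 u0 up]] := rS i iS.
  exists (fun k => `|u ord0 k|%N); have := ku; rewrite unfold_in /ker_beta /=
    /beta.
  rewrite (bigID (mem S)) /= (bigD1 i) //= big1 ?addr0 =>
    [/eqP|k /andP[kS ki]]; last first.
    by rewrite [u _ _]u0 // mulr0z.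
  rewrite [u _ _]u1 mulrN1z => /eqP; rewrite addrC subr_eq0 => /eqP <-.
  apply: eq_big => [k|k kS]; first by rewrite inE.
  by rewrite pmulrn gez0_abs //; exact: up.
have [c cE] := gS i iS.
pose u := \row_k (if k \in S then - (k == i)%:Z else (c k)%:Z).
have ku : u \in ker_beta a.
  rewrite unfold_in /ker_beta /beta (bigID (mem S)) /= (bigD1 i) //=.
  rewrite big1 ?addr0 => [|k /andP[kS /negPf ki]].
    rewrite mxE iS eqxx mulrN1z addrC subr_eq0 cE; apply/eqP.
    by apply: eq_big => [k|k /negPf kS]; rewrite ?inE // mxE kS -pmulrn.
  by rewrite mxE kS ki oppr0 mulr0z.
exists (Relation ku); rewrite /coord_ev /coord_fun /=; split.
- by rewrite mxE iS eqxx.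
- by move=> k kS /negPf ki; rewrite mxE kS ki oppr0.
- by move=> k /negPf kS; rewrite mxE kS.
Qed.

Lemma rooted_Gamma S : rooted coord_ev S <->
  semigroup_gen a (~: S) = semigroup_gen a [set: 'I_r]%SET.
Proof.
rewrite rooted_semigroup_gen; split=> [gS|eS i iS]; last first.
  by rewrite eS; exact: mem_semigroup_gen.
apply/seteqP; split; apply: semigroup_gen_sub => i _.
  exact: mem_semigroup_gen.
have [/gS//|iS] := boolP (i \in S); by apply: mem_semigroup_gen; rewrite inE.
Qed.

End Gamma.

Section Bidual.
Variable K : zmodType.

Definition eval_fun (u : K) (x : dual K) : int := x u.

Lemma eval_fun_is_zmod_morphism u : zmod_morphism (eval_fun u).
Proof. by []. Qed.

HB.instance Definition _ u :=
  GRing.isZmodMorphism.Build (dual K) int (eval_fun u)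
    (eval_fun_is_zmod_morphism u).

Definition eval_at (u : K) : dual (dual K) :=
  eval_fun u : {additive dual K -> int}.

Lemma torsionless_dual : torsionless (dual K).
Proof.
move=> x x0; have /existsNP[u xu] : ~ forall u, x u = 0.
  by apply: contra_neq_not x0 => xu; apply: dual_ext.
by exists (eval_at u); apply/eqP.
Qed.

End Bidual.

(** * The fan [SigmaPA] described by rooted sets of relations *)

Section SigmaPA.
Variables (P : zmodType) (r : nat) (a : 'I_r -> P).
Implicit Types (S : {set 'I_r}).

Lemma rooted_coord_dual S : rooted (coord_ev (a := a)) S ->
  rooted (dual_ev (Defs.coord a)) S.
Proof. exact: (rooted_map (f := @eval_at (relations a))). Qed.

(** Each cone of [Omega] is generated by its rays, and by [rooted_Gamma] the condition on [Gamma]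
    says that its set of ray indices is rooted. *)
Lemma SigmaPA_rooted : (forall i, rooted (coord_ev (a := a)) [set i]%SET) ->
  SigmaPA a = [set cone_of (fun i => toNQ (Defs.coord a i)) S
              | S in [set S | rooted (coord_ev (a := a)) S]].
Proof.
move=> rooted1; apply/seteqP; split=> [sigma [[ps scs rs] G]|_ [S rS <-]].
  exists (ray_indices a sigma); first exact/rooted_Gamma.
  apply/esym/cone_ofE => //; exact/separated_NQ/torsionless_dual.
have dS := rooted_dual_to (rooted_coord_dual rS).
have rays rho := cone_rays_cone_of rho dS.
split; first split.
- exact: polyhedral_cone_of.
- exact: strictly_convex_cone_of.
- by move=> rho /rays[i _ ->]; exists i.
(* Rootedness of singletons makes the rays pairwise distinct, so the ray indices of this cone are
   exactly [S]. *)
have -> : Gamma a (cone_of (fun i => toNQ (Defs.coord a i)) S) =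
    semigroup_gen a (~: S).
  congr (semigroup_gen a (~: _)); apply/setP => i; rewrite inE.
  apply/asboolP/idP => [/rays[k kS ik]|iS]; last by apply/rays; exists i.
  by rewrite (ray_of_inj (rooted_coord_dual (rooted1 i)) ik).
exact/rooted_Gamma.
Qed.

End SigmaPA.

(** * Maximal strongly regular fans *)

Section StronglyRegularFans.
Variables (N : zmodType) (r : nat) (n : 'I_r -> N) (Sigma : set (set (NQ N))).
Hypotheses (tN : torsionless N) (srS : strongly_regular Sigma).
Hypothesis raysS : fan_rays Sigma = range (fun i => ray_of (n i)).
Hypothesis prim_n : forall i, prim_gen (ray_of (n i)) = n i.
Hypothesis inj_n : injective n.

(** Distinct indices give distinct rays, because [prim_gen] recovers [n i] from its ray and [n] is
    injective. *)
Lemma root_ev e : Defs.root Sigma e -> exists i, e (n i) = -1 /\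
  forall k, k != i -> 0 <= e (n k).
Proof.
rewrite /Defs.root raysS => -[_ [[i _ <-]]]; rewrite /roots_at raysS prim_n =>
  -[e1 ep _].
exists i; split=> // k ki; rewrite -(prim_n k); apply: ep; first by exists k.
by apply: contra_neq_not ki => /(congr1 (@prim_gen N));
  rewrite !prim_n => /inj_n.
Qed.

(* A cone connected by a root e at the i-th ray with its facet tau is generated
   by tau and that ray: all its other rays lie in the kernel of e. *)
Lemma sub_rooted_fan : Sigma `<=` rooted_fan n.
Proof.
have [[_ polyS faceS _] conS] := srS.
(* Induction on the dimension, which for a nonzero cone is read off from the facet that strong
   regularity provides; the zero cone belongs to the empty set. *)
suff H d sigma : Sigma sigma -> cone_dim sigma d -> rooted_fan n sigma.
  move=> sigma Ss; have [->|] := pselect (sigma = [set 0]).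
    by exists finset.set0; [move=> i; rewrite inE|rewrite cone_of0].
  by move=> /(conS _ Ss)[tau [e [[_ [d [_ dd]]] _ _]]]; exact: H dd.
elim: d sigma => [|d IHd] sigma Ss ds.
  have [->|] := pselect (sigma = [set 0]).
    by exists finset.set0; [move=> i; rewrite inE|rewrite cone_of0].
  move=> /(conS _ Ss)[tau [e [[_ [d [_ ds']]] _ _]]].
  by have := cone_dim_unique ds ds'.
have [s0|] := pselect (sigma = [set 0]).
  by have := cone_dim_unique ds; rewrite s0 => /(_ _ (cone_dim0 _)).
move=> /(conS _ Ss)[tau [e [[ft [d' [dt ds']]] /root_ev[i [e1 ep]] [se te]]]].
have [d'd] := cone_dim_unique ds ds'; rewrite -d'd in dt.
have [S rS tS] := IHd tau (faceS _ _ Ss ft) dt.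
have [u eu uE] := pairing_scalar e.
have e0 k : k \in S -> e (n k) = 0.
  move=> /(mem_cone_of (fun k => toNQ (n k))); rewrite tS te => -[_].
  by rewrite -eu uE => /eqP; rewrite intr_eq0 => /eqP.
exists (i |: S)%SET; first exact: rootedU1 e1 e0 ep.
have [ps scs] := polyS _ Ss.
have [s [es rays]] := cone_rays_generate (separated_NQ tN) ps scs.
have ray x : x \in s -> exists k, cone_hull [set x] = ray_of (n k).
  move=> /rays[fx dx]; have : fan_rays Sigma (cone_hull [set x]).
    by split=> //; exact: faceS fx.
  by rewrite raysS => -[k _ <-]; exists k.
have sn x k : x \in s -> cone_hull [set x] = ray_of (n k) -> sigma (toNQ (n k)).
  move=> xs xk; have : cone_hull [set x] (toNQ (n k)).
    by rewrite xk; exact: sub_cone_hull.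
  by rewrite es; apply: cone_hullS => _ ->.
(* On [n k] the root [e] is nonpositive as on all of [sigma], and nonnegative because [k] differs
   from [i]. *)
have si x k : x \in s -> cone_hull [set x] = ray_of (n k) -> k != i -> tau x.
  move=> xs xk ki; rewrite te; split; first by rewrite es; exact: sub_cone_hull.
  have nk : pairing (toNQ (n k)) e = 0.
    apply/le_anti; rewrite se /=; last exact: sn xk.
    by rewrite -eu uE ler0z; exact: ep.
  have : cone_hull [set x] x by exact: sub_cone_hull.
  rewrite xk /ray_of cone_hull1 => -[t _ ->].
  by rewrite -eu linearZ /= eu nk mulr0.
have ctau : convex_cone tau by rewrite -tS; exact: convex_cone_of.
(* Otherwise all rays of [sigma] would lie in [tau], whose dimension is smaller. *)
have nis : sigma (toNQ (n i)).
  apply: contrapT => nis; suff : (d.+1 <= d)%N by rewrite ltnn.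
  apply: cone_dimS ds dt; rewrite {1}es; apply: cone_hull_min => // x xs.
  have [k xk] := ray x xs; apply: (si x k) => //.
  by apply: contra_notN nis => /eqP <-; exact: sn xk.
rewrite -cone_ofU1 tS; apply/seteqP; split.
  rewrite es; apply: cone_hull_sub; rewrite -es => v [|].
    by rewrite te => -[].
  move: v; apply: cone_hull_min => [|_ -> //].
  by rewrite es; exact: convex_cone_hull.
rewrite {1}es; apply: cone_hull_sub => x xs; apply: sub_cone_hull.
have [k xk] := ray x xs; have [ki|ki] := eqVneq k i; last by left;
  exact: si xk ki.
by right; rewrite -ki -[cone_hull _]xk; exact: sub_cone_hull.
Qed.

(** The ray of [n i] is a cone of [Sigma], hence the cone of a rooted set; having dimension one, it
    is the ray of an index in that set, which must be [i]. *)
Lemma rooted_singleton i : rooted (dual_ev n) [set i]%SET.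
Proof.
have [Si di] : fan_rays Sigma (ray_of (n i)) by rewrite raysS; exists i.
have [S rS eS] := sub_rooted_fan Si.
move: di; rewrite -eS => /(cone_dim_cone_of1 (rooted_dual_to rS))[k kS].
rewrite eS => ik; have <- : k = i.
  by apply: inj_n; rewrite -(prim_n i) ik prim_n.
by apply: rootedS rS; rewrite finset.sub1set.
Qed.

Lemma maximal_rooted_fan : maximal_strongly_regular Sigma ->
  Sigma = rooted_fan n.
Proof.
move=> [_ maxS]; apply: contrapT => neq; apply: maxS; exists (rooted_fan n);
  split.
- apply: strongly_regular_rooted_fan => //; exact: rooted_singleton.
- by rewrite raysS fan_rays_rooted_fan //; exact: rooted_singleton.
- rewrite properEneq; split; [exact/eqP|exact: sub_rooted_fan].
Qed.

End StronglyRegularFans.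

(** * Dual bases and reflexivity of lattices *)

Section Lattices.
Variables (N : zmodType) (latN : is_lattice N).

Lemma lattice_dual_basis : exists (m : nat) (b : 'I_m -> N)
    (b' : 'I_m -> dual N),
  forall x, x = \sum_i b i *~ b' i x.
Proof.
have [m [f [h hf fh]]] := latN.
have hB : zmod_morphism h := can2_zmod_morphism hf fh.
pose c i x := h x ord0 i.
have cB i : zmod_morphism (c i) by move=> x y; rewrite /c hB !mxE.
pose b' i : {additive N -> int} :=
  HB.pack (c i) (GRing.isZmodMorphism.Build _ _ (c i) (cB i)).
exists m, (fun i => f (delta_mx ord0 i)), b' => x.
rewrite -[LHS]fh {1}(row_sum_delta (h x)) raddf_sum; apply: eq_bigr => i _.
by rewrite -[in LHS](intz (h x ord0 i)) scaler_int raddfMz.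
Qed.

Lemma torsionless_lattice : torsionless N.
Proof.
have [m [b [b' bE]]] := lattice_dual_basis.
move=> x x0; have /existsNP[i xi] : ~ forall i, b' i x = 0.
  by apply: contra_neq_not x0 => xi; rewrite (bE x) big1 // => i _;
    rewrite xi mulr0z.
by exists (b' i); apply/eqP.
Qed.

(** Applying [e] to the dual basis expansion gives [e] as the combination of the [b' i] with
    coefficients [e (b i)]; so the vector with coordinates [y (b' i)] represents [y]. *)
Lemma reflexive_lattice (y : dual (dual N)) : exists x, forall e, y e = e x.
Proof.
have [m [b [b' bE]]] := lattice_dual_basis.
exists (\sum_i b i *~ y (b' i)) => e.
have eE : e = \sum_i b' i *~ e (b i).
  apply: dual_ext => x; rewrite {1}(bE x) -[RHS]/(eval_at x _) !raddf_sum.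
  by apply: eq_bigr => i _; rewrite !raddfMz mulrzz mulrC -mulrzz.
rewrite {1}eE [LHS]raddf_sum [RHS]raddf_sum; apply: eq_bigr => i _.
by rewrite !raddfMz mulrzz mulrC -mulrzz.
Qed.

End Lattices.

(** * The class group of a family of vectors and its relations *)

Section ClassGroup.
Variables (N : zmodType) (r : nat) (n : 'I_r -> N).

Definition char_image : {pred 'rV[int]_r} :=
  fun u => `[< exists e : dual N, forall i, u ord0 i = e (n i) >].

Lemma char_image_zmod_closed : zmod_closed char_image.
Proof.
split=> [|u v]; first by apply/asboolP; exists 0 => i; rewrite mxE.
move=> /asboolP[e ue] /asboolP[f vf]; apply/asboolP; exists (e - f) => i.
by rewrite !mxE ue vf.
Qed.

HB.instance Definition _ :=
  GRing.isZmodClosed.Build 'rV[int]_r char_image char_image_zmod_closed.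

(** For the primitive vectors on the rays of a fan in a lattice, this is the divisor class group of
    the toric variety, and [divisor_class i] is the class of the invariant prime divisor of the i-th
    ray. *)
Definition class_group : zmodType := Quotient.quot char_image.

Definition divisor_class (i : 'I_r) : class_group :=
  \pi_(Quotient.quot char_image) (delta_mx ord0 i).

Lemma beta_divisor_class (u : 'rV[int]_r) :
  beta divisor_class u = \pi_(Quotient.quot char_image) u.
Proof.
rewrite [in RHS](row_sum_delta u) raddf_sum; apply: eq_bigr => i _.
by rewrite -[in RHS](intz (u ord0 i)) scaler_int raddfMz.
Qed.

Lemma ker_beta_divisor_class (u : 'rV[int]_r) :
  reflect (exists e : dual N, forall i, u ord0 i = e (n i))
    (u \in ker_beta divisor_class).
Proof.
apply: (equivP idP); rewrite unfold_in /ker_beta beta_divisor_class.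
rewrite -(raddf0 (\pi_(Quotient.quot char_image))) -Quotient.idealrBE subr0.
by split=> /asboolP.
Qed.

Lemma char_relation (e : dual N) : exists u : relations divisor_class,
  forall i, coord_ev u i = e (n i).
Proof.
have eu : \row_i e (n i) \in ker_beta divisor_class.
  by apply/ker_beta_divisor_class; exists e => i; rewrite mxE.
by exists (Relation eu) => i; rewrite /coord_ev /coord_fun mxE.
Qed.

Lemma relation_char (u : relations divisor_class) :
  exists e : dual N, forall i, e (n i) = coord_ev u i.
Proof.
by case: u => u ku; have /ker_beta_divisor_class[e ue] := ku; exists e => i;
  rewrite -ue.
Qed.

Lemma rooted_divisor_class (S : {set 'I_r}) :
  rooted (dual_ev n) S <-> rooted (coord_ev (a := divisor_class)) S.
Proof.
split; last by have /choice[f fE] := relation_char; exact: rooted_map fE.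
by have /choice[f fE] := char_relation; exact: rooted_map fE.
Qed.

(** By [rooted_semigroup_gen], rootedness of the singleton of [i] puts the i-th class in the
    semigroup generated by the others. *)
Lemma admissible_divisor_class :
  (forall i, rooted (dual_ev n) [set i]%SET) -> admissible divisor_class.
Proof.
move=> rooted1; split=> [p|i].
  exists (repr p ord0); rewrite -[LHS]reprK -beta_divisor_class.
  by [].
have /rooted_divisor_class/rooted_semigroup_gen := rooted1 i.
by apply; rewrite inE.
Qed.

(** When characters are determined by their values on the [n i], the relations form a copy of
    [dual N]; dualizing and using reflexivity identifies [N] with the dual of the relations. *)
Lemma lattice_biduality : is_lattice N ->
  (forall e : dual N, (forall i, e (n i) = 0) -> e = 0) ->
  exists phi : {additive N -> dual (relations divisor_class)},
    bijective phi /\ forall i, phi (n i) = Defs.coord divisor_class i.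
Proof.
move=> latN ext0.
have ext (e f : dual N) : (forall i, e (n i) = f (n i)) -> e = f.
  move=> ef; apply/subr0_eq/ext0 => i; rewrite -[LHS]/(e (n i) - f (n i)).
  by rewrite ef subrr.
have /choice[char charE] := relation_char.
have /choice[rel relE] := char_relation.
have relK : cancel rel char by move=> e; apply: ext => i; rewrite charE relE.
have charB : zmod_morphism char.
  move=> u v; apply: ext => i; rewrite -[RHS]/(char u (n i) - char v (n i))
    !charE.
  by rewrite /coord_ev raddfB.
have charK : cancel char rel.
  move=> u; apply/val_inj/rowP => i; rewrite -[LHS]/(coord_ev _ i) relE charE.
  by [].
have relB : zmod_morphism rel.
  by move=> e f; apply: (can_inj charK); rewrite charB !relK.
pose phi0 x (u : relations divisor_class) : int := char u x.
have phi0B x : zmod_morphism (phi0 x) by move=> u v; rewrite /phi0 charB.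
pose phi1 x : {additive relations divisor_class -> int} :=
  HB.pack (phi0 x) (GRing.isZmodMorphism.Build _ _ (phi0 x) (phi0B x)).
pose phi2 x : dual (relations divisor_class) := phi1 x.
have phi2B : zmod_morphism phi2.
  by move=> x y; apply: dual_ext => u; rewrite -[LHS]/(char u (x - y)) raddfB.
pose phi : {additive N -> dual (relations divisor_class)} :=
  HB.pack phi2 (GRing.isZmodMorphism.Build _ _ phi2 phi2B).
exists phi; split; last first.
  by move=> i; apply: dual_ext => u; rewrite -[LHS]/(char u (n i)) charE.
have phi_inj : injective phi.
  apply: raddf_inj => x /(congr1 (fun y : dual _ => y _)) phix.
  have [//|/(torsionless_lattice latN)[e]] := eqVneq x 0.
  by rewrite -(relK e) -[char _ x]/(phi x (rel e)) phix eqxx.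
have phi_surj y : exists x, phi x = y.
  (* The functional [y] is pulled back along [rel] to the bidual of [N], where reflexivity supplies
     a preimage. *)
  pose psi0 (e : dual N) : int := y (rel e).
  have psi0B : zmod_morphism psi0 by move=> e f; rewrite /psi0 relB raddfB.
  pose psi : {additive dual N -> int} :=
    HB.pack psi0 (GRing.isZmodMorphism.Build _ _ psi0 psi0B).
  have [x xE] := reflexive_lattice latN (psi : dual (dual N)).
  exists x; apply: dual_ext => u.
  by rewrite -[LHS]/(char u x) -xE -[LHS]/(y (rel (char u))) charK.
have /choice[psi psiE] := phi_surj.
by exists psi => // x; apply: phi_inj; rewrite psiE.
Qed.

End ClassGroup.

(** * Indexing the rays of a fan and transporting its cones *)

Lemma fan_rays_enum (N : zmodType) (Sigma : set (set (NQ N))) :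
  torsionless N -> is_fan Sigma ->
  exists (r : nat) (n : 'I_r -> N),
    [/\ fan_rays Sigma = range (fun i => ray_of (n i)),
        forall i, prim_gen (ray_of (n i)) = n i & injective n].
Proof.
move=> tN [[finS _] polyS _ _].
have rayE rho : fan_rays Sigma rho -> ray_of (prim_gen rho) = rho.
  move=> [/polyS[[X [_ eX]] srho] drho].
  by apply/esym/prim_gen_ray; rewrite // eX; exact: convex_cone_hull.
have /finite_seqP[s es] : finite_set (fan_rays Sigma).
  by apply: sub_finite_set finS => rho [].
have mem_s rho : (rho \in undup s) = (rho \in s) by rewrite mem_undup.
(* Removing repetitions makes the indexing of rays injective. *)
pose rays := undup s; pose rho (i : 'I_(size rays)) := nth set0 rays i.
have rhoS i : fan_rays Sigma (rho i) by rewrite es /= -mem_s mem_nth.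
exists (size rays), (fun i => prim_gen (rho i)); split.
- rewrite es; apply/seteqP; split=> [t /= ts|_ [i _ <-]].
    have ti : (index t rays < size rays)%N by rewrite index_mem mem_s.
    have ti' : rho (Ordinal ti) = t by rewrite /rho nth_index ?mem_s.
    by exists (Ordinal ti); rewrite // rayE // ti'.
  by rewrite rayE //= -mem_s mem_nth.
- by move=> i; rewrite rayE.
- move=> i k /(congr1 (@ray_of N)); rewrite !rayE // => /eqP.
  by rewrite nth_uniq ?undup_uniq // => /eqP/val_inj.
Qed.

(** The rational extension of [e] vanishes on every ray, hence on their span, which contains the
    image of [N]. *)
Lemma characters_separated (N : zmodType) (r : nat) (n : 'I_r -> N)
    (e : dual N) :
  lin_span (\bigcup_(rho in range (fun i => ray_of (n i))) rho) = setT ->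
  (forall i, e (n i) = 0) -> e = 0.
Proof.
move=> span e0; apply: dual_ext => x; have [u _ uE] := pairing_scalar e.
have : lin_span (\bigcup_(rho in range (fun i => ray_of (n i))) rho) (toNQ x).
  by rewrite span.
move=> [m [c [v [vr xE]]]]; apply/eqP; rewrite -(intr_eq0 rat) -uE xE
  linear_sum.
rewrite big1 // => j _; have [_ [i _ <-]] := vr j.
rewrite /ray_of cone_hull1 => -[t _ ->].
by rewrite !linearZ /= uE e0 !mulr0.
Qed.

Lemma mapQ_image_cone_of (N N' : zmodType) (r : nat) (n : 'I_r -> N)
    (phi : {additive N -> N'}) (S : {set 'I_r}) :
  mapQ phi @` cone_of (fun i => toNQ (n i)) S =
  cone_of (fun i => toNQ (phi (n i))) S.
Proof.
pose f : {additive N -> NQ N'} := toNQ \o phi.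
have mapQ_linear : linear (mapQ phi) by exact: (extQ_linear f).
pose L : {linear NQ N -> NQ N'} :=
  HB.pack (mapQ phi) (GRing.isLinear.Build _ _ _ _ (mapQ phi) mapQ_linear).
rewrite -[LHS]/(L @` _) cone_hull_image; congr cone_hull.
rewrite image_comp; apply: eq_imagel => i _; exact: (extQ_toNQ f).
Qed.

Theorem corollary2 (N : zmodType) (latN : is_lattice N)
  (Sigma : set (set (NQ N))) (maxS : maximal_strongly_regular Sigma)
  (spanS : rays_span Sigma) :
  exists (P : zmodType) (r : nat) (a : 'I_r -> P),
    admissible a /\
    exists phi : {additive N -> dual (relations a)},
      bijective phi /\ [set mapQ phi @` sigma | sigma in Sigma] = SigmaPA a.
Proof.
have tN := torsionless_lattice latN.
have [srS _] := maxS; have [fanS _] := srS.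
have [r [n [raysS prim_n inj_n]]] := fan_rays_enum tN fanS.
have rooted1 := rooted_singleton tN srS raysS prim_n inj_n.
exists (class_group n), r, (divisor_class n); split.
  exact: admissible_divisor_class.
have [|phi [phi_bij phi_n]] := lattice_biduality (n := n) latN.
  by move=> e; apply: characters_separated; rewrite -raysS.
exists phi; split=> //.
rewrite SigmaPA_rooted => [|i]; last exact/rooted_divisor_class.
rewrite (maximal_rooted_fan tN srS raysS prim_n inj_n maxS).
(* Both fans are now indexed by rooted sets, and [phi] matches their generating vectors. *)
have imageE S : mapQ phi @` cone_of (fun i => toNQ (n i)) S =
    cone_of (fun i => toNQ (Defs.coord (divisor_class n) i)) S.
  by rewrite mapQ_image_cone_of; congr cone_of; apply/funext => i;
    rewrite phi_n.
apply/seteqP; split=> [_ [_ [S rS <-] <-]|_ [S rS <-]].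
  by exists S; [exact/rooted_divisor_class|rewrite imageE].
by exists (cone_of (fun i => toNQ (n i)) S); [exists S => //;
  exact/rooted_divisor_class|].
Qed.
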